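(* Let $p\colon V\to M$ be a real vector bundle over a $C^\infty$-manifold, endowed with a positive definite symmetric bilinear form $\langle\cdot,\cdot\rangle\colon V\oplus V=V\times_M V\to\mathbb{R}$. A diffeomorphism $\varphi\colon M\to M$ can be lifted to an automorphism $\Phi\colon V\to V$ if and only if $\varphi$ can be lifted to an isometry of the metric vector bundle $(V,\langle\cdot,\cdot\rangle)$.
   Context: All manifolds are connected, second countable, $C^\infty$, without boundary and finite-dimensional; all maps, bundles and fibre metrics are $C^\infty$. An automorphism of $V$ is a diffeomorphism $\Phi\colon V\to V$ mapping each fibre $V_x$ onto a fibre $V_{x'}$ by an $\mathbb{R}$-linear isomorphism $\Phi_x$; it is a lift of the diffeomorphism $\varphi$ of $M$ if $x'=\varphi(x)$ for all $x\in M$. An isometry of $(V,\langle\cdot,\cdot\rangle)$ lifting $\varphi$ is an automorphism $\Phi$ lifting $\varphi$ such that each $\Phi_x\colon (V_x,\langle\cdot,\cdot\rangle_x)\to(V_{\varphi(x)},\langle\cdot,\cdot\rangle_{\varphi(x)})$ is a linear isometry. *)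

(* Defs.v *)
From HB Require Import structures.
From mathcomp Require Import all_boot all_order all_algebra.
From mathcomp Require Import boolp classical_sets cardinality reals.
From mathcomp Require Import topology normedtype derive.

Set Implicit Arguments.
Unset Strict Implicit.
Unset Printing Implicit Defensive.

Import Order.TTheory GRing.Theory Num.Theory.
Import numFieldNormedType.Exports.

Local Open Scope classical_set_scope.
Local Open Scope ring_scope.

(* Only meaningful for [O] open.  A map is C^{k+1} iff it is differentiable and
   its differential is C^k; as the target of the differential is the
   finite-dimensional space of linear maps, the latter is tested vector by
   vector. *)
Fixpoint Ck (R : realType) (m n k : nat) (O : set 'rV[R]_m)
    (f : 'rV[R]_m -> 'rV[R]_n) : Prop :=
  match k with
  | 0 => forall x, O x -> {for x, continuous f}
  | k'.+1 => (forall x, O x -> differentiable f x) /\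
             (forall v : 'rV[R]_m, Ck k' O (fun x => 'd f x v))
  end.

Definition Cinfty (R : realType) (m n : nat) (O : set 'rV[R]_m)
    (f : 'rV[R]_m -> 'rV[R]_n) : Prop :=
  forall k, Ck k O f.

(* A chart is given by total functions; [cmap] is only relevant on [cdom], and
   [cinv] on [cmap @` cdom]. *)
Record chart (R : realType) (T : Type) (n : nat) := Chart {
  cdom : set T;
  cmap : T -> 'rV[R]_n;
  cinv : 'rV[R]_n -> T
}.

Record charted_space (R : realType) := ChartedSpace {
  carrier :> topologicalType;
  dim : nat;
  atlas : set (chart R carrier dim)
}.

Definition is_chart (R : realType) (T : topologicalType) (n : nat)
    (c : chart R T n) : Prop :=
  [/\ open (cdom c),
      open (cmap c @` cdom c),
      forall x, cdom c x -> cinv c (cmap c x) = x,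
      forall x, cdom c x -> {for x, continuous (cmap c)}
    & forall y, (cmap c @` cdom c) y -> {for y, continuous (cinv c)}].

(* The dimension is constant since manifolds are connected; the atlas need not
   be maximal. *)
Definition is_manifold (R : realType) (M : charted_space R) : Prop :=
  [/\ hausdorff_space M, @second_countable M & connected [set: M]] /\
  [/\ forall c, @atlas R M c -> is_chart c,
      forall x : M, exists2 c, atlas c & cdom c x
    & forall c d, @atlas R M c -> atlas d ->
        Cinfty (cmap c @` (cdom c `&` cdom d)) (cmap d \o cinv c)].

Record manifold (R : realType) := Manifold {
  manifold_space :> charted_space R;
  manifoldP : is_manifold manifold_space
}.

Definition euclid (R : realType) (n : nat) : charted_space R :=
  @ChartedSpace R 'rV[R]_n n [set Chart setT id id].

Definition prod_chart (R : realType) (S T : Type) (m n : nat)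
    (c : chart R S m) (d : chart R T n) : chart R (S * T)%type (m + n) :=
  Chart (cdom c `*` cdom d)
        (fun z => row_mx (cmap c z.1) (cmap d z.2))
        (fun y => (cinv c (lsubmx y), cinv d (rsubmx y))).

Definition prod_space (R : realType) (M N : charted_space R) :
    charted_space R :=
  @ChartedSpace R (M * N)%type (dim M + dim N)
    [set e | exists c d, [/\ @atlas R M c, @atlas R N d & e = prod_chart c d]].

(* Smoothness on a subset [A], which is meant to be open. *)
Definition smooth_on (R : realType) (M N : charted_space R) (A : set M)
    (f : M -> N) : Prop :=
  (forall x, A x -> {for x, continuous f}) /\
  (forall c d, @atlas R M c -> @atlas R N d ->
     Cinfty (cmap c @` (cdom c `&` A `&` f @^-1` cdom d))
            (cmap d \o f \o cinv c)).

Definition diffeomorphism (R : realType) (M N : charted_space R)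
    (f : M -> N) : Prop :=
  smooth_on setT f /\
  exists g : N -> M, [/\ cancel f g, cancel g f & smooth_on setT g].

(* The fibre over [x] is a vector space [fibre x], identified with the subset
   [proj @^-1` [set x]] of the total space by [incl]. *)
Record fibred_space (R : realType) (M : charted_space R) := FibredSpace {
  total :> manifold R;
  proj : total -> M;
  fibre : M -> lmodType R;
  incl : forall x : M, fibre x -> total;
  proj_incl : forall (x : M) (e : fibre x), proj (incl e) = x;
  incl_inj : forall x : M, injective (@incl x);
  incl_surj : forall v : total, exists e : fibre (proj v), incl e = v
}.

(* The map [v |-> (proj v, t v)] is a diffeomorphism from [proj @^-1` U] onto
   [U `*` setT] with inverse [s], and is linear on the fibres. *)
Definition local_trivialization (R : realType) (M : charted_space R)
    (V : fibred_space M) (r : nat) (U : set M) (t : V -> euclid R r)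
    (s : prod_space M (euclid R r) -> V) : Prop :=
  [/\ open U,
      forall v, U (proj v) -> s (proj v, t v) = v
    & forall x a, U x -> proj (s (x, a)) = x /\ t (s (x, a)) = a] /\
  [/\ smooth_on (@proj R M V @^-1` U)
        ((fun v => (proj v, t v)) : V -> prod_space M (euclid R r)),
      @smooth_on R (prod_space M (euclid R r)) V (U `*` setT) s
    & forall x, U x -> linear ((fun e => t (incl e)) : fibre V x -> 'rV[R]_r)].

(* The rank is constant since the base is connected. *)
Record vector_bundle (R : realType) (M : manifold R) := VectorBundle {
  bundle_space :> fibred_space M;
  rank : nat;
  proj_smooth : smooth_on setT (@proj R M bundle_space);
  locally_trivial : forall x : M, exists U t s,
    U x /\ @local_trivialization R M bundle_space rank U t s
}.

(* Smoothness of a family of forms is smoothness of the induced function on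
   the Whitney sum of [V] with itself, whose manifold structure is given by the
   identifications of its restriction to [U] with [U * 'rV_r * 'rV_r] obtained
   from the local trivializations; [h] is the form read in these coordinates,
   and real values are regarded as elements of ['rV_1]. *)
Definition smooth_form (R : realType) (M : manifold R) (V : vector_bundle M)
    (g : forall x : M, fibre V x -> fibre V x -> R) : Prop :=
  forall U t s, @local_trivialization R M V (rank V) U t s ->
  exists h : M * ('rV[R]_(rank V) * 'rV[R]_(rank V)) -> R,
    (forall x (a b : fibre V x), U x ->
       g x a b = h (x, (t (incl a), t (incl b)))) /\
    @smooth_on R
      (prod_space M (prod_space (euclid R (rank V)) (euclid R (rank V))))
      (euclid R 1) (U `*` setT) (fun z => (h z)%:M).

Record bundle_metric (R : realType) (M : manifold R) (V : vector_bundle M) :=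
  BundleMetric {
    form :> forall x : M, fibre V x -> fibre V x -> R;
    form_sym : forall x (a b : fibre V x), form a b = form b a;
    form_linear : forall x (a : fibre V x), scalar (form a);
    form_posdef : forall x (a : fibre V x), a != 0 -> 0 < form a a;
    form_smooth : smooth_form form
  }.

Section Automorphisms.
Variables (R : realType) (M : manifold R) (V : vector_bundle M).
Implicit Types (Phi : V -> V) (phi : M -> M).

Definition restricts_to Phi (x y : M) (L : fibre V x -> fibre V y) : Prop :=
  forall a, Phi (incl a) = incl (L a).

Definition automorphism Phi : Prop :=
  diffeomorphism Phi /\
  forall x : M, exists (y : M) (L : {linear fibre V x -> fibre V y}),
    bijective L /\ restricts_to Phi L.

Definition lifts Phi phi : Prop :=
  forall v : V, proj (Phi v) = phi (proj v).

Definition isometry_lifting (g : bundle_metric V) Phi phi : Prop :=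
  [/\ automorphism Phi, lifts Phi phi
    & forall x : M, exists2 L : {linear fibre V x -> fibre V (phi x)},
        restricts_to Phi L & forall a b, g (phi x) (L a) (L b) = g x a b].

End Automorphisms.

(* Main.v *)
Require Import Defs.
From HB Require Import structures.
From mathcomp Require Import all_boot all_order all_algebra.
From mathcomp Require Import boolp classical_sets functions cardinality reals.
From mathcomp Require Import topology normedtype derive landau.
From mathcomp Require Import ring.
From mathcomp Require complex.

(** The isometry is the polar part [Psi] of the automorphism [Phi]: fibrewise,
    [Psi_x] is the unique linear isometry from [V_x] to [V_(phi x)] for which
    [(a, b) |-> g (Psi_x a) (Phi_x b)] is symmetric and positive definite.  Being
    characterised without any choice, the [Psi_x] fit together globally, and the
    inverse of [Psi] is the polar part of the inverse of [Phi], so that it is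
    enough to see that polar parts are smooth.  In local trivializations, [Psi] is
    a rational expression in the matrix of [Phi] and in square roots of positive
    definite matrices.  The square root [P] of a smooth family [S] is smooth
    because two square roots satisfy the Sylvester equation
    [D *m P x + P y *m D = S y - S x] with [D = P y - P x], whose solution operator
    is bounded: this gives the continuity of [P], then its differentiability, with
    a differential which is a rational function of [P] and ['d S]; smoothness
    follows by induction on the order. *)

Set Implicit Arguments.
Unset Strict Implicit.
Unset Printing Implicit Defensive.

Import Order.TTheory GRing.Theory Num.Theory.
Import numFieldNormedType.Exports.
Import Defs.

Local Open Scope classical_set_scope.
Local Open Scope ring_scope.

(** * Positive definite matrices and polar decomposition *)

Section PositiveDefinite.
Context {R : rcfType}.

Definition posdefmx n (S : 'M[R]_n) : Prop :=
  S^T = S /\ forall v : 'rV_n, v != 0 -> 0 < (v *m S *m v^T) 0 0.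

Lemma dot_mx_ge0 n (v : 'rV[R]_n) : 0 <= (v *m v^T) 0 0.
Proof. by rewrite mxE sumr_ge0 // => i _; rewrite mxE -expr2 sqr_ge0. Qed.

Lemma dot_mx_gt0 n (v : 'rV[R]_n) : v != 0 -> 0 < (v *m v^T) 0 0.
Proof.
move=> v0; rewrite lt_def dot_mx_ge0 andbT; apply: contra_neq v0 => vv0.
apply/rowP => i; rewrite mxE; apply/eqP; rewrite -sqrf_eq0; apply/eqP.
move: vv0; rewrite mxE => /psumr_eq0P -/(_ _ i isT); rewrite mxE -expr2.
by apply=> j _; rewrite mxE -expr2 sqr_ge0.
Qed.

Lemma posdefmx_unit n (S : 'M[R]_n) : posdefmx S -> S \in unitmx.
Proof.
move=> [_ Spos]; rewrite -row_free_unit; apply: inj_row_free => v vS0.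
by apply: contra_eq vS0 => /Spos; apply: contraTneq => ->; rewrite mul0mx mxE ltxx.
Qed.

Lemma posdefmx_congr n (A S : 'M[R]_n) : A \in unitmx -> posdefmx S ->
  posdefmx (A *m S *m A^T).
Proof.
move=> Au [St Spos]; split; first by rewrite !trmx_mul trmxK St mulmxA.
move=> v v0; have vA0 : v *m A != 0.
    by apply: contra_neq v0 => vA0; rewrite -[v](mulmxK Au) vA0 mul0mx.
by have := Spos _ vA0; rewrite trmx_mul !mulmxA.
Qed.

Lemma posdefmx1 n : posdefmx (1%:M : 'M[R]_n).
Proof. by split=> [|v v0]; rewrite ?trmx1 // mulmx1 dot_mx_gt0. Qed.

Lemma posdefmx_mulTr n (A : 'M[R]_n) : A \in unitmx -> posdefmx (A *m A^T).
Proof.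
move=> Au; rewrite -[A in A *m _]mulmx1.
by apply: posdefmx_congr => //; apply: posdefmx1.
Qed.

Lemma posdefmx_eigenvalue n (S : 'M[R]_n) a :
  posdefmx S -> eigenvalue S a -> 0 < a.
Proof.
move=> [_ Spos] /eigenvalueP [v vS v0].
by have := Spos v v0; rewrite vS -scalemxAl mxE pmulr_lgt0 // dot_mx_gt0.
Qed.

(** Newton interpolation: the value at a new node is corrected by a multiple of [w], whose roots are
    exactly the earlier nodes. *)
Lemma ex_interpolation_poly (F : fieldType) (s : seq F) (f : F -> F) :
  exists q : {poly F}, {in s, forall x, q.[x] = f x}.
Proof.
elim: s => [|a s [q qf]]; first by exists 0.
have [as_|as_] := boolP (a \in s).
  by exists q => x; rewrite inE => /predU1P[->|]; apply: qf.
pose w := \prod_(b <- s) ('X - b%:P).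
have wa : w.[a] != 0 by rewrite -[_ == 0]/(root w a) root_prod_XsubC.
exists (q + ((f a - q.[a]) / w.[a]) *: w) => x.
rewrite inE hornerD hornerZ => /predU1P[->|xs]; first by rewrite divfK // subrKC.
have /rootP -> : root w x by rewrite root_prod_XsubC.
by rewrite mulr0 addr0 qf.
Qed.

Lemma trmx_horner n (A : 'M[R]_n.+1) q : A^T = A ->
  (horner_mx A q)^T = horner_mx A q.
Proof.
move=> At; elim/poly_ind: q => [|q c IH]; first by rewrite rmorph0 trmx0.
rewrite rmorphD rmorphM /= horner_mx_X horner_mx_C linearD /= tr_scalar_mx.
by rewrite trmx_mul IH At -(comm_horner_mx q (erefl (A *m A))).
Qed.

Import complex.

(** Over the complex numbers [S] is Hermitian, hence unitarily diagonalizable with a real diagonal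
    [X], and a polynomial in [S] is conjugate to the same polynomial in [X]. Polynomial identities
    in [S] can thus be checked on its eigenvalues. *)
Lemma symmx_spectrum n (S : 'M[R]_n.+1) : S^T = S ->
  exists2 s : seq R, {in s, forall a, eigenvalue S a}
    & forall q, {in s, forall a, q.[a] = 0} -> horner_mx S q = 0.
Proof.
move=> St; pose toC := real_complex R; pose SC := map_mx toC S.
have toC_real a : toC a \is Num.real by apply/complex_realP; exists a.
have SCreal : SC \is a mxOver Num.real by apply/mxOverP=> i j; rewrite mxE.
have SCsym : SC \is symmetricmx.
  apply/is_hermitianmxP; rewrite expr0 scale1r map_mx_id //.
  by rewrite {1}/SC -St; apply/matrixP=> i j; rewrite !mxE.
have SCherm := realsym_hermsym SCsym SCreal.
have /hermitian_normalmx /orthomx_spectralP SCE := SCherm.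
set P := spectralmx SC in SCE; set X := spectral_diag SC in SCE.
have Pu : P \in unitmx by apply: spectral_unit.
have XE i : X 0 i = toC (complex.Re (X 0 i)).
  have /mxOverP /(_ 0 i) := hermitian_spectral_diag_real SCherm.
  by case/complex_realP => a; rewrite -/X => ->.
exists [seq complex.Re (X 0 i) | i <- enum 'I_n.+1].
  move=> _ /mapP [i _ ->]; suff : eigenvalue SC (X 0 i).
    rewrite XE eigenvalue_root_char -map_char_poly fmorph_root.
    by rewrite eigenvalue_root_char.
  apply/eigenvalueP.
  (* [SC] is the conjugate of the diagonal matrix of [X] by [P], so the rows of [P] are left
     eigenvectors; they are nonzero because [P] is invertible. *)
  exists (row i P); last first.
    apply: contraTneq Pu => Pi0; rewrite -row_free_unit; apply/negP => /row_freeP [B].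
    move=> /(congr1 (row i)) /rowP /(_ i); rewrite row_mul Pi0 mul0mx !mxE eqxx.
    by move/esym/eqP; rewrite oner_eq0.
  rewrite -/SC SCE -row_mul mulmxA mulmxA mulmxV // mul1mx.
  by rewrite row_mul row_diag_mx -scalemxAl -rowE.
move=> q qs; apply: (@map_mx_inj _ _ toC).
rewrite map_mx0 map_horner_mx -/SC SCE horner_mx_uconjC // horner_mx_diag.
suff -> : map_mx (horner (map_poly toC q)) X = 0 by rewrite linear0 mulmx0 mul0mx.
apply/rowP => i; rewrite !mxE XE horner_map qs ?rmorph0 //.
by apply/mapP; exists i; rewrite ?mem_enum.
Qed.

(** The root is a polynomial in [S]. Interpolating the fourth roots of the eigenvalues yields a
    symmetric [Q] whose fourth power is [S], so that [Q *m Q = Q *m Q^T] is positive definite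
    without a further look at its spectrum. *)
Lemma posdefmx_sqrt_exists n (S : 'M[R]_n) : posdefmx S ->
  exists P, posdefmx P /\ P *m P = S.
Proof.
(* Evaluating polynomials at a matrix requires positive size; in size 0 all matrices agree. *)
case: n S => [|n] S Spd.
  by exists S; split=> //; rewrite [RHS]flatmx0 [LHS]flatmx0.
have [St _] := Spd; have [s seig shorner] := symmx_spectrum St.
have [q qs] := ex_interpolation_poly s (fun a => Num.sqrt (Num.sqrt a)).
have q4 : horner_mx S (q ^+ 4) = S.
  apply/eqP; rewrite -subr_eq0 -{2}(horner_mx_X S) -rmorphB /=; apply/eqP.
  apply: shorner => a sa; have a0 := posdefmx_eigenvalue Spd (seig a sa).
  rewrite hornerD hornerN hornerX horner_exp qs // (exprM _ 2 2).
  by rewrite !sqr_sqrtr ?sqrtr_ge0 ?subrr // ltW.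
pose Q := horner_mx S q.
have Qt : Q^T = Q by apply: trmx_horner.
have Q4 : Q *m Q *m (Q *m Q) = S.
  by rewrite -[RHS]q4 rmorphXn /= -/Q !exprS expr0 mulr1 -!mulmxE !mulmxA.
have Qu : Q \in unitmx.
  by have := posdefmx_unit Spd; rewrite -Q4 -mulmxA unitmx_mul => /andP[].
exists (Q *m Q); split=> //.
by rewrite -{2}Qt; apply: posdefmx_mulTr.
Qed.
End PositiveDefinite.

(** * The Sylvester equation, and square roots and polar factors of matrices *)

Section Sylvester.
Context {R : realType}.

Lemma ler_mx_norm m n (A : 'M[R]_(m, n)) i j : `|A i j| <= `|A|.
Proof.
rewrite [leRHS]/Num.Def.normr /= mx_normrE.
exact: (le_bigmax _ (fun ij : 'I_m * 'I_n => `|A ij.1 ij.2|) (i, j)).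
Qed.

Lemma mx_norm_le m n (A : 'M[R]_(m, n)) (c : R) :
  0 <= c -> (forall i j, `|A i j| <= c) -> `|A| <= c.
Proof.
move=> c0 Ac; rewrite [leLHS]/Num.Def.normr /= mx_normrE.
by apply: bigmax_le => // -[i j] _; apply: Ac.
Qed.

(** The norm is the largest absolute value of an entry, and each entry of the product is a sum of
    [n] terms. *)
Lemma mulmx_norm_le m n p (A : 'M[R]_(m, n)) (B : 'M[R]_(n, p)) :
  `|A *m B| <= n%:R * `|A| * `|B|.
Proof.
apply: mx_norm_le => [|i j]; first by rewrite !mulr_ge0.
rewrite mxE (le_trans (ler_norm_sum _ _ _)) //.
rewrite (le_trans (ler_sum _ (G := fun=> `|A| * `|B|) _)) //.
  by move=> k _; rewrite normrM ler_pM // ler_mx_norm.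
by rewrite sumr_const card_ord -[leLHS]mulr_natl mulrA.
Qed.

Lemma mxtrace_gram m n (A : 'M[R]_(m, n)) :
  \tr (A *m A^T) = \sum_i \sum_j A i j ^+ 2.
Proof.
by apply: eq_bigr => i _; rewrite mxE; apply: eq_bigr => j _; rewrite mxE expr2.
Qed.

(** The trace is the squared Frobenius norm, which dominates the square of every entry. *)
Lemma mx_norm_sqr_le m n (A : 'M[R]_(m, n)) : `|A| ^+ 2 <= \tr (A *m A^T).
Proof.
have tr0 : 0 <= \tr (A *m A^T).
  by rewrite mxtrace_gram; do 2![apply: sumr_ge0 => ? _]; rewrite sqr_ge0.
rewrite -[leRHS]sqr_sqrtr // ler_pXn2r ?nnegrE ?sqrtr_ge0 //.
apply: mx_norm_le => [|i j]; first exact: sqrtr_ge0.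
rewrite -sqrtr_sqr ler_wsqrtr // mxtrace_gram (bigD1 i) //= (bigD1 j) //=.
rewrite -addrA lerDl addr_ge0 // ?sumr_ge0 // => k _.
  exact: sqr_ge0.
by apply: sumr_ge0 => l _; rewrite sqr_ge0.
Qed.

Lemma mxtrace_mul_le m n (A B : 'M[R]_(m, n)) :
  \tr (A^T *m B) <= (m * n)%:R * `|A| * `|B|.
Proof.
rewrite /mxtrace (le_trans (ler_norm _)) // (le_trans (ler_norm_sum _ _ _)) //.
have -> : (m * n)%:R * `|A| * `|B| = \sum_(j < n) m%:R * `|A| * `|B|.
  by rewrite sumr_const card_ord -[RHS]mulr_natl natrM; ring.
apply: ler_sum => j _; rewrite mxE (le_trans (ler_norm_sum _ _ _)) //.
rewrite (le_trans (ler_sum _ (G := fun=> `|A| * `|B|) _)) //.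
  by move=> k _; rewrite mxE normrM ler_pM // ler_mx_norm.
by rewrite sumr_const card_ord -[leLHS]mulr_natl mulrA.
Qed.

(** Each diagonal entry is the value of the form [P] on a row of [A]. *)
Lemma mxtrace_posdef_ge0 n (P A : 'M[R]_n) :
  posdefmx P -> 0 <= \tr (A *m P *m A^T).
Proof.
move=> [_ Ppos]; apply: sumr_ge0 => i _.
have -> : (A *m P *m A^T) i i = (row i A *m P *m (row i A)^T) 0 0.
  by rewrite -row_mul [RHS]mxE [LHS]mxE; apply: eq_bigr => j _; rewrite !mxE.
have [->|/Ppos/ltW//] := eqVneq (row i A) 0.
by rewrite !mul0mx mxE.
Qed.

(* Pairing [D *m P + P' *m D] with [D] bounds it below by [tr (D P D^T)]
   uniformly in [P']. *)
Lemma sylvester_bound n (P : 'M[R]_n) : posdefmx P ->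
  exists2 K : R, 0 <= K & forall P' D : 'M[R]_n, posdefmx P' ->
    `|D| <= K * `|D *m P + P' *m D|.
Proof.
move=> Ppd; have [Q [Qpd QQ]] := posdefmx_sqrt_exists Ppd.
have Qu := posdefmx_unit Qpd; have [Qt _] := Qpd.
(* [k] comes from [D = D *m Q *m invmx Q]; the factor [n * n] below comes from bounding a trace by
   maximum norms. *)
pose k := n%:R * `|invmx Q|.
exists (k ^+ 2 * (n * n)%:R); first by rewrite mulr_ge0 ?sqr_ge0.
move=> P' D P'pd; set H := D *m P + P' *m D.
have [->|D0] := eqVneq D 0; first by rewrite normr0 mulr_ge0 // mulr_ge0 ?sqr_ge0.
rewrite -(ler_pM2l (x := `|D|)) ?normr_gt0 // -expr2.
have DQ : `|D| <= k * `|D *m Q|.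
  rewrite -{1}[D](mulmxK Qu) (le_trans (mulmx_norm_le _ _)) //.
  by rewrite /k -!mulrA [`|_| * `|_|]mulrC.
have {}DQ : `|D| ^+ 2 <= k ^+ 2 * \tr (D^T *m H).
  have k0 : 0 <= k by rewrite mulr_ge0.
  apply: (@le_trans _ _ (k ^+ 2 * `|D *m Q| ^+ 2)).
    by rewrite -exprMn ler_pXn2r ?nnegrE // mulr_ge0.
  apply: ler_wpM2l; first exact: sqr_ge0.
  rewrite (le_trans (mx_norm_sqr_le _)) // /H mulmxDr linearD /=.
  have -> : D *m Q *m (D *m Q)^T = D *m P *m D^T.
    by rewrite trmx_mul Qt -QQ !mulmxA.
  (* The remaining summand [\tr (D^T *m P' *m D)] is nonnegative, whatever the positive definite
     [P']. *)
  rewrite (mxtrace_mulC D^T) lerDl mulmxA -{2}[D]trmxK.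
  exact: mxtrace_posdef_ge0.
apply: le_trans DQ _.
have -> : `|D| * (k ^+ 2 * (n * n)%:R * `|H|) =
    k ^+ 2 * ((n * n)%:R * `|D| * `|H|) by ring.
by apply: ler_wpM2l (mxtrace_mul_le _ _); exact: sqr_ge0.
Qed.

Lemma sylvester_eq0 n (P P' D : 'M[R]_n) : posdefmx P -> posdefmx P' ->
  D *m P + P' *m D = 0 -> D = 0.
Proof.
move=> /sylvester_bound [K _ KP] P'pd HD; have KD := KP P' D P'pd.
by apply/eqP; rewrite -normr_le0; move: KD; rewrite HD normr0 mulr0.
Qed.

(** Choosing the root with [xget] makes it a total function of [S]; the default value 0 is taken
    when [S] has no positive definite root. *)
Definition sqrtmx n (S : 'M[R]_n) : 'M[R]_n :=
  xget 0 [set P | posdefmx P /\ P *m P = S].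

Lemma sqrtmxP n (S : 'M[R]_n) : posdefmx S ->
  posdefmx (sqrtmx S) /\ sqrtmx S *m sqrtmx S = S.
Proof. by move=> /posdefmx_sqrt_exists; apply: xgetPex. Qed.

(** The difference [D] of two positive definite roots [Q] and [P] of the same matrix satisfies
    [D *m P + Q *m D = 0]. *)
Lemma sqrtmx_unique n (P : 'M[R]_n) : posdefmx P -> sqrtmx (P *m P) = P.
Proof.
move=> Ppd; have [|Qpd QQ] := @sqrtmxP _ (P *m P).
  by rewrite -{2}(proj1 Ppd); apply/posdefmx_mulTr/posdefmx_unit.
apply/eqP; rewrite -subr_eq0; apply/eqP/(sylvester_eq0 Ppd Qpd).
by rewrite mulmxBl mulmxBr QQ subrKA subrr.
Qed.

(** Matrices act on row vectors. [At] is [A] read in the orthonormal coordinates that the square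
    roots of the Gram matrices [G] and [G'] provide. With [P] the square root of [At *m At^T], the
    orthogonal factor [invmx P *m At] is written as [P *m invmx At^T], and then carried back to the
    original coordinates. *)
Definition polarmx n (G G' A : 'M[R]_n) : 'M[R]_n :=
  let At := invmx (sqrtmx G) *m A *m sqrtmx G' in
  sqrtmx G *m sqrtmx (At *m At^T) *m invmx At^T *m invmx (sqrtmx G').

(** In orthonormal coordinates the two claims say that the factor [Q] is orthogonal and that
    [Q *m At^T] is the positive definite matrix [P]; congruence by the root of [G] gives them in
    general. *)
Lemma polarmxP n (G G' A : 'M[R]_n) :
  posdefmx G -> posdefmx G' -> A \in unitmx ->
  let B := polarmx G G' A in B *m G' *m B^T = G /\ posdefmx (B *m G' *m A^T).
Proof.
move=> Gpd G'pd Au; rewrite /polarmx.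
have [Cpd CC] := sqrtmxP Gpd; have [C'pd CC'] := sqrtmxP G'pd.
move: (sqrtmx G) (sqrtmx G') Cpd CC C'pd CC' => C C' Cpd <- C'pd <-.
have Cu := posdefmx_unit Cpd; have C'u := posdefmx_unit C'pd.
have [Ct _] := Cpd; have [C't _] := C'pd.
set At := _ *m A *m _.
have Atu : At \in unitmx by rewrite !unitmx_mul unitmx_inv Cu Au.
have AE : A = C *m At *m invmx C' by rewrite /At !mulmxA mulmxV // mul1mx mulmxK.
clearbody At.
have [Ppd PP] := sqrtmxP (posdefmx_mulTr Atu).
move: (sqrtmx _) Ppd PP => P Ppd PP; have [Pt _] := Ppd.
have Pu := posdefmx_unit Ppd.
have Attu : At^T \in unitmx by rewrite unitmx_tr.
have ABt X : X *m (C' *m C') *m A^T = X *m C' *m At^T *m C.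
  by rewrite AE !trmx_mul trmx_inv C't Ct !mulmxA (mulmxK C'u).
split.
  rewrite -(mulmxA C); set Q := P *m invmx At^T.
  have QQ : Q *m Q^T = 1%:M.
    rewrite /Q trmx_mul trmx_inv trmxK Pt -mulmxA (mulmxA (invmx At^T)).
    apply: mulmx1C; rewrite -(mulmxA _ P P) PP mulmxA -(mulmxA (invmx At^T)).
    by rewrite mulVmx // mulmx1 mulVmx.
  clearbody Q.
  rewrite !trmx_mul trmx_inv C't Ct !mulmxA.
  by rewrite (mulmxKV C'u) (mulmxK C'u) -(mulmxA C) QQ mulmx1.
by rewrite ABt (mulmxKV C'u) (mulmxKV Attu) -{2}Ct; apply: posdefmx_congr.
Qed.

Lemma polarmx_unique n (G G' A B : 'M[R]_n) :
  posdefmx G -> posdefmx G' -> A \in unitmx ->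
  B *m G' *m B^T = G -> posdefmx (B *m G' *m A^T) -> B = polarmx G G' A.
Proof.
move=> Gpd G'pd Au; rewrite /polarmx.
have [Cpd CC] := sqrtmxP Gpd; have [C'pd CC'] := sqrtmxP G'pd.
move: (sqrtmx G) (sqrtmx G') Cpd CC C'pd CC' => C C' Cpd <- C'pd <-.
have Cu := posdefmx_unit Cpd; have C'u := posdefmx_unit C'pd.
have [Ct _] := Cpd; have [C't _] := C'pd => BB BA.
set At := _ *m A *m _.
have Atu : At^T \in unitmx by rewrite unitmx_tr !unitmx_mul unitmx_inv Cu Au.
pose Q := invmx C *m B *m C'.
have QQ : Q^T *m Q = 1%:M.
  apply: mulmx1C.
  have -> : Q *m Q^T = invmx C *m (B *m (C' *m C') *m B^T) *m invmx C.
    by rewrite /Q !trmx_mul trmx_inv C't Ct !mulmxA.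
  by rewrite BB mulmxA mulVmx // mul1mx mulmxV.
have QAt : posdefmx (Q *m At^T).
  have -> : Q *m At^T = invmx C *m (B *m (C' *m C') *m A^T) *m (invmx C)^T.
    by rewrite /Q /At !trmx_mul C't !mulmxA.
  by apply: posdefmx_congr; rewrite ?unitmx_inv.
have -> : B = C *m Q *m invmx C' by rewrite /Q !mulmxA mulmxV // mul1mx mulmxK.
clearbody Q At.
(* [Q *m At^T] is symmetric, hence equal to [At *m Q^T], and its square is [At *m At^T]; uniqueness
   of the square root then determines [Q]. *)
have -> : At *m At^T = Q *m At^T *m (Q *m At^T).
  by rewrite -{1}(proj1 QAt) trmx_mul trmxK !mulmxA -(mulmxA At) QQ mulmx1.
by rewrite sqrtmx_unique // mulmxA mulmxK.
Qed.
End Sylvester.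

(** * Calculus of C^k maps *)

Section CkCalculus.
Context {R : realType}.

(* [Ck] for arbitrary normed modules, to cover real- and matrix-valued maps. *)
Fixpoint Ckg (U W : normedModType R) (k : nat) (O : set U) (f : U -> W) : Prop :=
  match k with
  | 0 => forall x, O x -> {for x, continuous f}
  | k'.+1 => (forall x, O x -> differentiable f x) /\
             (forall v, Ckg k' O (fun x => 'd f x v))
  end.

Lemma CkgE m n k (O : set 'rV[R]_m) (f : 'rV[R]_m -> 'rV[R]_n) :
  Ck k O f <-> Ckg k O f.
Proof.
elim: k f => [|k IH] f //=; split=> -[df dfv]; split=> // v; exact/IH/dfv.
Qed.

Section Generic.
Variables (U : normedModType R).

Lemma CkgS (W : normedModType R) k (O : set U) (f : U -> W) :
  Ckg k.+1 O f -> Ckg k O f.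
Proof.
elim: k f => [|k IH] f [df dfv]; first by move=> x /df/differentiable_continuous.
by split=> // v; apply: IH; apply: dfv.
Qed.

Lemma Ckg_continuous (W : normedModType R) k (O : set U) (f : U -> W) x :
  Ckg k O f -> O x -> {for x, continuous f}.
Proof. by elim: k => [|k IH]; [apply|move/CkgS]. Qed.

(** The first-order expansion of [f] at [x] is also one of [g], and such an expansion determines the
    differential. *)
Lemma near_eq_diff (W : normedModType R) (f g : U -> W) x :
  (\forall y \near x, f y = g y) -> differentiable f x ->
  differentiable g x /\ 'd g x = 'd f x :> (U -> W).
Proof.
move=> fg df; have fgx := nbhs_singleton fg.
have gE : g \o shift x = cst (g x) + 'd f x +o_ 0 id.
  apply/eqaddoP => e e0.
  have /eqaddoP /(_ e e0) := diff_locally df.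
  have fg0 : \forall y \near (0 : U), f (y + x) = g (y + x).
    by move: fg; rewrite (near_shift 0 x) subr0.
  apply: filterS2 fg0 => y /= fgy.
  by rewrite !fctE /= -fgx -fgy.
have dg := diff_unique (@diff_continuous _ _ _ _ _ df) gE.
split=> //; apply/diff_locallyP; split; first by rewrite dg; exact: diff_continuous.
by rewrite dg.
Qed.

Lemma Ckg_eq (W : normedModType R) k (O : set U) (f g : U -> W) : open O ->
  (forall x, O x -> f x = g x) -> Ckg k O f -> Ckg k O g.
Proof.
move=> oO; elim: k f g => [|k IH] f g fg.
  move=> fc x Ox; suff : g @ x --> g x by [].
  rewrite -(fg x Ox).
  apply: cvg_trans (fc x Ox); apply: near_eq_cvg.
  by apply: filterS (open_nbhs_nbhs (conj oO Ox)) => y /fg ->.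
have nfg x : O x -> \forall y \near x, f y = g y.
  by move=> Ox; apply: filterS (open_nbhs_nbhs (conj oO Ox)) => y /fg ->.
move=> [df dfv]; split=> [x Ox|v].
  by have [] := near_eq_diff (nfg x Ox) (df x Ox).
apply: IH (dfv v) => x Ox.
by have [_ ->] := near_eq_diff (nfg x Ox) (df x Ox).
Qed.

Lemma Ckg_cst (W : normedModType R) k (O : set U) (c : W) : Ckg k O (fun=> c).
Proof.
elim: k c => [|k IH] c; first by move=> x _; apply: cst_continuous.
split=> [x _|v]; first exact: differentiable_cst.
rewrite (_ : (fun x => _) = fun=> 0); first exact: IH.
by apply/funext => x; rewrite diff_cst.
Qed.

Lemma Ckg_linear (W W' : normedModType R) k (O : set U) (f : U -> W)
    (l : {linear W -> W'}) :
  open O -> continuous l -> Ckg k O f -> Ckg k O (fun x => l (f x)).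
Proof.
move=> oO lc; elim: k f => [|k IH] f.
  by move=> fc x Ox; apply: continuous_comp; [exact: fc|exact: lc].
have dl y : differentiable l y by apply: linear_differentiable.
move=> [df dfv]; split=> [x Ox|v].
  by apply: differentiable_comp (df x Ox) _.
apply: Ckg_eq oO _ (IH _ (dfv v)) => x Ox.
by rewrite (diff_comp (df x Ox) (dl _)) /= diff_lin.
Qed.

Lemma CkgD (W : normedModType R) k (O : set U) (f g : U -> W) : open O ->
  Ckg k O f -> Ckg k O g -> Ckg k O (fun x => f x + g x).
Proof.
move=> oO; elim: k f g => [|k IH] f g.
  by move=> fc gc x Ox; apply: continuousD; [exact: fc|exact: gc].
move=> [df dfv] [dg dgv]; split=> [x Ox|v].
  by apply: differentiableD; [exact: df|exact: dg].
apply: Ckg_eq oO _ (IH _ _ (dfv v) (dgv v)) => x Ox.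
exact: (esym (congr1 (fun h : U -> W => h v) (diffD (df x Ox) (dg x Ox)))).
Qed.

Lemma CkgM k (O : set U) (f g : U -> R) : open O ->
  Ckg k O f -> Ckg k O g -> Ckg k O (fun x => f x * g x).
Proof.
move=> oO; elim: k f g => [|k IH] f g.
  by move=> fc gc x Ox; apply: continuousM; [exact: fc|exact: gc].
move=> fk gk; have [df dfv] := fk; have [dg dgv] := gk; split=> [x Ox|v].
  by apply: differentiableM; [exact: df|exact: dg].
apply: Ckg_eq oO _ (CkgD oO (IH _ _ (CkgS fk) (dgv v)) (IH _ _ (CkgS gk) (dfv v))).
move=> x Ox.
exact: (esym (congr1 (fun h : U -> R => h v) (diffM (df x Ox) (dg x Ox)))).
Qed.

(** The differential of the inverse is the differential of [f] times [- f^-2], which involves the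
    inverse at one order less; this closes the induction. *)
Lemma CkgV k (O : set U) (f : U -> R) : open O ->
  (forall x, O x -> f x != 0) -> Ckg k O f -> Ckg k O (fun x => (f x)^-1).
Proof.
move=> oO f0; elim: k => [|k IH].
  by move=> fc x Ox; apply: continuousV; [exact: f0|exact: fc].
move=> fk; have [df dfv] := fk; split=> [x Ox|v].
  by apply: differentiableV; [exact: df|exact: f0].
have Vk := IH (CkgS fk).
have Dk : Ckg k O (fun x => - 1 * ((f x)^-1 * (f x)^-1) * 'd f x v).
  apply: CkgM (dfv v) => //; apply: CkgM => //; first exact: Ckg_cst.
  exact: CkgM.
apply: Ckg_eq oO _ Dk => x Ox.
rewrite mulN1r -expr2 exprVn.
exact: (esym (congr1 (fun h : U -> R => h v) (diffV (df x Ox) (f0 x Ox)))).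
Qed.

Lemma Ckg_sum (W : normedModType R) k (O : set U) (I : Type) (r : seq I) (P : pred I)
    (F : I -> U -> W) : open O ->
  (forall i, P i -> Ckg k O (F i)) -> Ckg k O (fun x => \sum_(i <- r | P i) F i x).
Proof.
move=> oO FP; elim: r => [|i r IH].
  by under eq_fun do rewrite big_nil; apply: Ckg_cst.
under eq_fun do rewrite big_cons.
have [Pi|_] := boolP (P i); last exact: IH.
by apply: CkgD => //; apply: FP.
Qed.

Lemma Ckg_prod k (O : set U) (I : Type) (r : seq I) (P : pred I)
    (F : I -> U -> R) : open O ->
  (forall i, P i -> Ckg k O (F i)) -> Ckg k O (fun x => \prod_(i <- r | P i) F i x).
Proof.
move=> oO FP; elim: r => [|i r IH].
  by under eq_fun do rewrite big_nil; apply: Ckg_cst.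
under eq_fun do rewrite big_cons.
have [Pi|_] := boolP (P i); last exact: IH.
by apply: CkgM => //; apply: FP.
Qed.
End Generic.

(** * Matrix-valued maps, entry by entry *)

Section Matrices.
Variables (U : normedModType R).

Lemma diff_mx_entry m n (F : U -> 'M[R]_(m, n)) x i j : differentiable F x ->
  'd (fun y => F y i j) x = (fun v => 'd F x v i j) :> (U -> R).
Proof.
move=> dF; have dc := @differentiable_coord R m n (F x) i j.
rewrite (diff_comp dF dc); apply/funext => v /=.
have cl : linear (fun N : 'M[R]_(m, n) => N i j : R) by move=> a A B; rewrite !mxE.
pose cM := GRing.isLinear.Build _ _ _ _ _ cl.
pose c : {linear 'M[R]_(m, n) -> R} := HB.pack (fun N : 'M[R]_(m, n) => N i j) cM.
by rewrite (@diff_lin _ _ _ c) // => y; apply: coord_continuous.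
Qed.

Lemma differentiable_mx m n (F : U -> 'M[R]_(m, n)) x :
  (forall i j, differentiable (fun y => F y i j : R) x) -> differentiable F x.
Proof.
move=> dF.
have -> : F = \sum_(i < m) \sum_(j < n) (fun y => F y i j *: (delta_mx i j : 'M[R]_(m, n))).
  apply/funext => y; rewrite [LHS]matrix_sum_delta fct_sumE.
  by apply: eq_bigr => i _; rewrite fct_sumE.
by do 2!apply: differentiable_sum => ?; apply: differentiableZl.
Qed.

Lemma continuous_mx (T : topologicalType) m n (F : T -> 'M[R]_(m, n)) x :
  (forall i j, {for x, continuous (fun y => F y i j : R)}) -> {for x, continuous F}.
Proof.
move=> Fc A [P FP PA].
have FxP : \forall y \near x, forall i j, P i j (F y i j).
  by apply: filter_forall => i; apply: filter_forall => j; apply: Fc (FP i j).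
by apply: filterS FxP => y Py; apply: PA.
Qed.

Lemma Ckg_mx k (O : set U) m n (F : U -> 'M[R]_(m, n)) : open O ->
  Ckg k O F <-> forall i j, Ckg k O (fun x => F x i j : R).
Proof.
move=> oO; split=> [Fk i j|].
  elim: k F Fk => [|k IH] F.
    move=> Fc x Ox; apply: (@continuous_comp _ _ _ F (fun A => A i j)).
      exact: Fc.
    exact: coord_continuous.
  move=> [dF dFv]; split=> [x Ox|v].
    exact: differentiable_comp (dF x Ox) (differentiable_coord _ _ _).
  by apply: Ckg_eq oO _ (IH _ (dFv v)) => x Ox; rewrite diff_mx_entry //; exact: dF.
elim: k F => [|k IH] F Fk.
  by move=> x Ox; apply: continuous_mx => i j; apply: Fk.
have dF x : O x -> differentiable F x.
  by move=> Ox; apply: differentiable_mx => i j; apply: (proj1 (Fk i j)).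
split=> // v; apply: IH => i j.
apply: Ckg_eq oO _ (proj2 (Fk i j) v) => x Ox.
by rewrite diff_mx_entry //; exact: dF.
Qed.

Lemma Ckg_comp (n k : nat) (O : set U) (O' : set 'rV[R]_n) (f : U -> 'rV[R]_n)
    (g : 'rV[R]_n -> R) :
  open O -> open O' -> (forall x, O x -> O' (f x)) ->
  Ckg k O f -> Ckg k O' g -> Ckg k O (fun x => g (f x)).
Proof.
move=> oO oO' ff'; elim: k f g ff' => [|k IH] f g ff' fk gk.
  move=> x Ox; apply: continuous_comp; first exact: fk.
  by apply: gk; apply: ff'.
have [df dfv] := fk; have [dg dgv] := gk; split=> [x Ox|v].
  by apply: differentiable_comp; [exact: df|apply/dg/ff'].
(* The differential of [g] is known to be of class C^k only on fixed vectors, so the moving vector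
   ['d f x v] is expanded in the standard basis. *)
have Sk : Ckg k O (fun x =>
    \sum_(i < n) ('d f x v) 0 i * 'd g (f x) (delta_mx 0 i : 'rV[R]_n)).
  apply: Ckg_sum => // i _; apply: CkgM => //.
    by have /(Ckg_mx _ _ oO) := dfv v; apply.
  exact: (IH f (fun z => 'd g z (delta_mx 0 i)) ff' (CkgS fk) (dgv _)).
apply: Ckg_eq oO _ Sk => x Ox.
rewrite (diff_comp (df x Ox) (dg _ (ff' x Ox))) /= [X in _ = 'd g _ X]row_sum_delta.
by rewrite linear_sum /=; apply: eq_bigr => i _; rewrite linearZ.
Qed.

Lemma Ckg_mulmx k (O : set U) m n p (F : U -> 'M[R]_(m, n)) (G : U -> 'M[R]_(n, p)) :
  open O -> Ckg k O F -> Ckg k O G -> Ckg k O (fun x => F x *m G x).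
Proof.
move=> oO /(Ckg_mx _ _ oO) Fk /(Ckg_mx _ _ oO) Gk; apply/(Ckg_mx _ _ oO) => i j.
by under eq_fun do rewrite mxE; apply: Ckg_sum => // l _; apply: CkgM.
Qed.

Lemma Ckg_trmx k (O : set U) m n (F : U -> 'M[R]_(m, n)) :
  open O -> Ckg k O F -> Ckg k O (fun x => (F x)^T).
Proof.
move=> oO /(Ckg_mx _ _ oO) Fk; apply/(Ckg_mx _ _ oO) => i j.
by under eq_fun do rewrite mxE.
Qed.

Lemma Ckg_det k (O : set U) n (F : U -> 'M[R]_n) :
  open O -> Ckg k O F -> Ckg k O (fun x => \det (F x)).
Proof.
move=> oO /(Ckg_mx _ _ oO) Fk; rewrite /determinant.
apply: Ckg_sum => // s _; apply: CkgM => //; first exact: Ckg_cst.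
by apply: Ckg_prod => // i _.
Qed.

(** By Cramer's rule the entries of the inverse are rational functions of those of [F], with
    denominator the determinant. *)
Lemma Ckg_invmx k (O : set U) n (F : U -> 'M[R]_n) : open O ->
  (forall x, O x -> F x \in unitmx) -> Ckg k O F -> Ckg k O (fun x => invmx (F x)).
Proof.
move=> oO Fu Fk.
have Ik : Ckg k O (fun x => (\det (F x))^-1 *: \adj (F x)).
  apply/(Ckg_mx _ _ oO) => i j; under eq_fun do rewrite mxE.
  apply: CkgM => //.
    by apply: CkgV; [| |exact: Ckg_det] => // x Ox; rewrite -unitfE -unitmxE Fu.
  under eq_fun do rewrite mxE; rewrite /cofactor.
  apply: CkgM => //; first exact: Ckg_cst.
  apply: Ckg_det => //; apply/(Ckg_mx _ _ oO) => a b.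
  by under eq_fun do rewrite !mxE; have /(Ckg_mx _ _ oO) := Fk.
by apply: Ckg_eq oO _ Ik => x Ox; rewrite /invmx Fu.
Qed.
End Matrices.

(** * Continuity and differentiability from norm estimates *)

Section Bounds.
Variables (U : normedModType R).

Lemma dominated_continuous (W W' : normedModType R) (f : U -> W) (g : U -> W') x (K : R) :
  (\forall y \near x, `|f y - f x| <= K * `|g y - g x|) ->
  {for x, continuous g} -> {for x, continuous f}.
Proof.
move=> fg gc; have /cvgrPdist_lt gcx : g @ x --> g x := gc.
apply/cvgrPdist_lt => e e0.
(* [K] may have any sign; its absolute value plus 1 is a positive upper bound by which one can
   divide. *)
have K1 : 0 < `|K| + 1 by rewrite ltr_wpDl.
near=> y; rewrite distrC.
have gy : `|g y - g x| < e / (`|K| + 1).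
  by rewrite distrC; near: y; apply: gcx; rewrite divr_gt0.
have fy : `|f y - f x| <= K * `|g y - g x| by near: y.
apply: le_lt_trans fy _; rewrite ltr_pdivlMr // mulrC in gy.
apply: le_lt_trans gy; apply: ler_wpM2r => //.
by rewrite (le_trans (ler_norm K)) // lerDl.
Unshelve. all: by end_near. Qed.

(** A quadratic bound is negligible to first order, so the zero map is the differential. *)
Lemma diff0_of_quadratic (W : normedModType R) (E : U -> W) x (C : R) : 0 <= C ->
  (\forall y \near x, `|E y - E x| <= C * `|y - x| ^+ 2) ->
  differentiable E x /\ 'd E x = (fun=> 0) :> (U -> W).
Proof.
move=> C0 Eq.
have E0 : E \o shift x = cst (E x) + (\0 : {linear U -> W}) +o_ 0 id.
  apply/eqaddoP => e e0; near=> y.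
  rewrite !fctE /= addr0.
  have Ey : `|E (y + x) - E x| <= C * `|y| ^+ 2.
    rewrite -[in leRHS](addrK x y); near: y.
    by move: Eq; rewrite (near_shift 0 x) subr0.
  apply: le_trans Ey _; rewrite expr2 mulrA ler_wpM2r //.
  have : `|y| <= e / (C + 1).
    by near: y; apply: nbhs0_le; rewrite divr_gt0 // ltr_wpDl.
  rewrite ler_pdivlMr ?ltr_wpDl // mulrC; apply: le_trans.
  by rewrite ler_wpM2r // lerDl.
have d0 : continuous (\0 : {linear U -> W}) by exact: cst_continuous.
have dE := diff_unique d0 E0.
split=> //; apply/diff_locallyP; split; first by rewrite dE; exact: d0.
by rewrite dE.
Unshelve. all: by end_near. Qed.

Lemma diff_lipschitz (W : normedModType R) (f : U -> W) x : differentiable f x ->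
  exists2 K : R, 0 <= K & \forall y \near x, `|f y - f x| <= K * `|y - x|.
Proof.
move=> df; have [k k0 dk] := linear_lipschitz (@diff_continuous _ _ _ _ _ df).
(* [k] bounds the differential, and 1 bounds the remainder of the expansion near [x]. *)
exists (k + 1); first by rewrite addr_ge0 // ltW.
have /eqaddoP /(_ 1 ltr01) := diff_locally df.
rewrite (near_shift 0 x) subr0; apply: filterS => y /=.
rewrite !fctE /= mul1r => fy.
rewrite addrK mulrDl mul1r -(subrK ('d f x y) (f _ - f x)).
by rewrite (le_trans (ler_normD _ _)) // addrC lerD // -addrA -opprD.
Qed.

(** This serves to differentiate a map that follows [l \o S] up to an error [E] with zero
    differential. *)
Lemma diff_add_linear (W W' : normedModType R) (E : U -> W') (S : U -> W)
    (l : {linear W -> W'}) x :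
  differentiable E x -> 'd E x = (fun=> 0) :> (U -> W') -> differentiable S x ->
  continuous l ->
  differentiable (E + (l \o S)) x /\
  'd (E + (l \o S)) x = (fun v => l ('d S x v)) :> (U -> W').
Proof.
move=> dE E0 dS lc; have dl : differentiable l (S x) by apply: linear_differentiable.
have dlS := differentiable_comp dS dl.
split; first exact: differentiableD.
rewrite (diffD dE dlS) E0 (diff_comp dS dl) (diff_lin _ lc).
by apply/funext => v /=; rewrite add0r.
Qed.
End Bounds.

(** * Smoothness of the square root of a family of positive definite matrices *)

Section SquareRoot.
Variables (U : normedModType R) (n : nat).

(** With the Sylvester operator of [P] written as a matrix on vectorized matrices, the smooth
    dependence of its inverse on [P] reduces to that of [invmx]. *)
Definition sylvmx (P : 'M[R]_n) : 'M[R]_(n * n) :=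
  lin_mx (mulmxr P \+ mulmx P).

Lemma mxvec_sylvmx P D : mxvec D *m sylvmx P = mxvec (D *m P + P *m D).
Proof. by rewrite mul_vec_lin. Qed.

Lemma sylvmx_unit P : posdefmx P -> sylvmx P \in unitmx.
Proof.
move=> Ppd; rewrite -row_free_unit; apply: inj_row_free => v.
rewrite -[v]vec_mxK mxvec_sylvmx => /eqP; rewrite mxvec_eq0 => /eqP vP.
by rewrite (sylvester_eq0 Ppd Ppd vP) linear0.
Qed.

Definition sylv_inv (P H : 'M[R]_n) : 'M[R]_n :=
  vec_mx (mxvec H *m invmx (sylvmx P)).

Lemma sylv_inv_eq P D : posdefmx P -> sylv_inv P (D *m P + P *m D) = D.
Proof.
by move=> Ppd; rewrite /sylv_inv -mxvec_sylvmx mulmxK ?mxvecK // sylvmx_unit.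
Qed.

Lemma sylv_inv_is_linear P : linear (sylv_inv P).
Proof. by move=> a A B; rewrite /sylv_inv linearP mulmxDl -scalemxAl linearP. Qed.
HB.instance Definition _ P := GRing.isLinear.Build R 'M[R]_n 'M[R]_n _ (sylv_inv P)
  (sylv_inv_is_linear P).

Lemma sylv_inv_bound P : exists2 K : R, 0 <= K & forall H, `|sylv_inv P H| <= K * `|H|.
Proof.
exists ((n * n)%:R * `|invmx (sylvmx P)|); first by rewrite mulr_ge0.
move=> H; apply: mx_norm_le => [|i j]; first by rewrite !mulr_ge0.
rewrite mxE (le_trans (ler_mx_norm _ _ _)) // (le_trans (mulmx_norm_le _ _)) //.
rewrite -!mulrA ler_wpM2l // mulrC ler_wpM2l //.
apply: mx_norm_le => // a b; rewrite [a]ord1; case/mxvec_indexP: b => i' j'.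
by rewrite mxvecE ler_mx_norm.
Qed.

Lemma sylv_inv_continuous P : continuous (sylv_inv P).
Proof.
move=> H; have [K _ KP] := sylv_inv_bound P.
have lip : \forall y \near H, `|sylv_inv P y - sylv_inv P H| <= K * `|id y - id H|.
  by apply: filterE => y; rewrite -linearB; apply: KP.
exact: (dominated_continuous lip (@cvg_id _ _)).
Qed.

Lemma Ckg_sylv_inv k (O : set U) (P H : U -> 'M[R]_n) : open O ->
  (forall x, O x -> posdefmx (P x)) -> Ckg k O P -> Ckg k O H ->
  Ckg k O (fun x => sylv_inv (P x) (H x)).
Proof.
move=> oO Ppd Pk Hk.
have vk : Ckg k O (fun x => mxvec (H x) *m invmx (sylvmx (P x))).
  apply: Ckg_mulmx => //.
    apply/(Ckg_mx _ _ oO) => a b; rewrite [a]ord1; case/mxvec_indexP: b => i j.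
    by under eq_fun do rewrite mxvecE; have /(Ckg_mx _ _ oO) := Hk.
  apply: Ckg_invmx => //; first by move=> x /Ppd; apply: sylvmx_unit.
  apply/(Ckg_mx _ _ oO) => a b; case/mxvec_indexP: b => i j.
  under eq_fun do rewrite mxE /= mxvecE.
  (* The row of index [a] of the Sylvester matrix is the vectorized image of the basis matrix
     [vec_mx (delta_mx 0 a)]. *)
  have Ek : Ckg k O (fun x => vec_mx (delta_mx 0 a) *m P x + P x *m vec_mx (delta_mx 0 a)).
    by apply: CkgD => //; apply: Ckg_mulmx => //; apply: Ckg_cst.
  by have /(Ckg_mx _ _ oO) := Ek; apply.
apply/(Ckg_mx _ _ oO) => i j; under eq_fun do rewrite mxE.
by have /(Ckg_mx _ _ oO) := vk; apply.
Qed.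

(** The bound on solutions of the Sylvester equation is uniform in its second coefficient, here the
    root of [S y]; hence [K] depends on [S x] only. *)
Lemma sqrtmx_lipschitz (S : U -> 'M[R]_n) x : posdefmx (S x) ->
  exists2 K : R, 0 <= K & forall y, posdefmx (S y) ->
   `|sqrtmx (S y) - sqrtmx (S x)| <= K * `|S y - S x|.
Proof.
move=> Sx; have [Px PPx] := sqrtmxP Sx.
have [K K0 KP] := sylvester_bound Px; exists K => // y Sy.
have [Py PPy] := sqrtmxP Sy.
have := KP _ (sqrtmx (S y) - sqrtmx (S x)) Py.
by rewrite mulmxBl mulmxBr PPx PPy [X in _ <= _ * `|X|]addrC subrKA.
Qed.

Lemma sqrtmx_continuous (O : set U) (S : U -> 'M[R]_n) x : open O -> O x ->
  (forall x, O x -> posdefmx (S x)) -> {for x, continuous S} ->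
  {for x, continuous (fun y => sqrtmx (S y))}.
Proof.
move=> oO Ox Spd Sc; have [K K0 KP] := sqrtmx_lipschitz (Spd x Ox).
apply: dominated_continuous Sc; near=> y; apply: KP; apply: Spd.
by near: y; apply: open_nbhs_nbhs.
Unshelve. all: by end_near. Qed.

(* For [P := sqrtmx \o S] and [D = P y - P x], one has [D *m P x + P y *m D = S y - S x], so that
   [D] agrees with [sylv_inv (P x) (S y - S x)] up to a quadratic error. *)
Lemma diff_sqrtmx (O : set U) (S : U -> 'M[R]_n) x : open O -> O x ->
  (forall x, O x -> posdefmx (S x)) -> differentiable S x ->
  differentiable (fun y => sqrtmx (S y)) x /\
  'd (fun y => sqrtmx (S y)) x = (fun v => sylv_inv (sqrtmx (S x)) ('d S x v))
    :> (U -> 'M[R]_n).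
Proof.
move=> oO Ox Spd dS; have [Px PPx] := sqrtmxP (Spd x Ox).
set P := fun y => sqrtmx (S y); pose l := sylv_inv (P x).
pose E y := P y - l (S y).
have [K1 K10 PL] := sqrtmx_lipschitz (Spd x Ox).
have [K2 K20 SL] := diff_lipschitz dS.
have [K3 K30 lL] := sylv_inv_bound (P x).
(* [K3] bounds [l], the factor [n] comes from the norm of a product, and [K1 * K2] is a Lipschitz
   constant of [P] at [x], obtained through [S]. *)
have [||dE E0] := @diff0_of_quadratic _ _ E x (K3 * (n%:R * (K1 * K2) ^+ 2)).
- by rewrite !mulr_ge0 // sqr_ge0.
- near=> y.
  have Sy : posdefmx (S y).
    by apply: Spd; near: y; apply: open_nbhs_nbhs.
  have [Py PPy] := sqrtmxP Sy.
  have -> : E y - E x = - l ((P y - P x) *m (P y - P x)).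
    have SE : S y - S x = (P y - P x) *m P x + P x *m (P y - P x)
        + (P y - P x) *m (P y - P x).
      rewrite -addrA -mulmxDl subrKC mulmxBl mulmxBr PPx PPy.
      by rewrite [RHS]addrC subrKA.
    have -> : E y - E x = (P y - P x) - l (S y - S x).
      have -> : l (S y - S x) = l (S y) - l (S x) by exact: linearB.
      rewrite /E !opprB [LHS]addrACA [RHS]addrACA.
      by rewrite [X in _ = _ + X]addrC.
    have -> : l (S y - S x) = P y - P x + l ((P y - P x) *m (P y - P x)).
      by rewrite SE -[X in _ = X + _](sylv_inv_eq _ Px); apply: linearD.
    by rewrite opprD addrA subrr add0r.
  rewrite normrN (le_trans (lL _)) // -!mulrA ler_wpM2l //.
  rewrite (le_trans (mulmx_norm_le _ _)) // -!mulrA ler_wpM2l //.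
  rewrite -[leLHS]expr2 [leRHS](_ : _ = (K1 * K2 * `|y - x|) ^+ 2); last by ring.
  rewrite ler_pXn2r ?nnegrE ?mulr_ge0 // (le_trans (PL y Sy)) // -mulrA ler_wpM2l //.
  by near: y.
have -> : P = E + (l \o S) by apply/funext => y; rewrite /= /E fctE subrK.
exact: (diff_add_linear dE E0 dS (@sylv_inv_continuous (P x))).
Unshelve. all: by end_near. Qed.

Lemma Ckg_sqrtmx k (O : set U) (S : U -> 'M[R]_n) : open O ->
  (forall x, O x -> posdefmx (S x)) -> Ckg k O S -> Ckg k O (fun x => sqrtmx (S x)).
Proof.
move=> oO Spd; elim: k => [|k IH].
  by move=> Sc x Ox; apply: sqrtmx_continuous oO Ox Spd (Sc x Ox).
move=> Sk; have [dS dSv] := Sk; split=> [x Ox|v].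
  by have [] := diff_sqrtmx oO Ox Spd (dS x Ox).
have Ppd x : O x -> posdefmx (sqrtmx (S x)) by move=> /Spd /sqrtmxP [].
apply: (Ckg_eq oO _ (Ckg_sylv_inv oO Ppd (IH (CkgS Sk)) (dSv v))) => x Ox.
have [_ dP] := diff_sqrtmx oO Ox Spd (dS x Ox).
exact: (esym (congr1 (fun h : U -> 'M[R]_n => h v) dP)).
Qed.
End SquareRoot.
End CkCalculus.

(** * Germs of smooth maps between normed spaces *)

Section Germs.
Context {R : realType}.
Implicit Types U W : normedModType R.

(** The differential is a total function of the base point, so [Ckg] is a conjunction of conditions
    at the single points of [Q], and it restricts to arbitrary subsets. *)
Lemma Ckg_pointwise U W k (Q : set U) (f : U -> W) :
  Ckg k Q f <-> forall x, Q x -> Ckg k [set x] f.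
Proof.
elim: k f => [|k IH] f.
  by split=> [fc x Ox _ ->|fc x Ox]; [apply: fc|apply: (fc x)].
split=> [[df dfv] x Ox|fO].
  by split=> [_ ->|v]; [apply: df|apply: (proj1 (IH _) (dfv v))].
split=> [x Ox|v]; first by have [df _] := fO x Ox; apply: df.
by apply/IH => x /fO [_ dfv]; apply: dfv.
Qed.

Lemma Ckg_subset U W k (Q D : set U) (f : U -> W) :
  Q `<=` D -> Ckg k D f -> Ckg k Q f.
Proof. by move=> OD /Ckg_pointwise fk; apply/Ckg_pointwise => x /OD /fk. Qed.

Definition smooth_germ U W (f : U -> W) (x : U) : Prop :=
  exists Q, [/\ open Q, Q x & forall k, Ckg k Q f].

Lemma smooth_germ_Cinfty m n (Q : set 'rV[R]_m) (f : 'rV[R]_m -> 'rV[R]_n) x :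
  open Q -> Q x -> Cinfty Q f -> smooth_germ f x.
Proof. by move=> oO Ox fO; exists Q; split=> // k; apply/CkgE. Qed.

Lemma Cinfty_smooth_germ m n (Q : set 'rV[R]_m) (f : 'rV[R]_m -> 'rV[R]_n) :
  (forall x, Q x -> smooth_germ f x) -> Cinfty Q f.
Proof.
move=> fO k; apply/CkgE/Ckg_pointwise => x /fO [D [_ Dx fk]].
by apply: Ckg_subset (fk k) => _ ->.
Qed.

Lemma smooth_germ_continuous U W (f : U -> W) x :
  smooth_germ f x -> {for x, continuous f}.
Proof. by move=> [Q [_ Ox fO]]; apply: Ckg_continuous (fO 0%N) Ox. Qed.

Lemma smooth_germ_cst U W (a : W) (x : U) : smooth_germ (fun=> a) x.
Proof. by exists setT; split=> // [|k]; [exact: openT|exact: Ckg_cst]. Qed.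

Lemma smooth_germ_linear U W (l : {linear U -> W}) x : continuous l -> smooth_germ l x.
Proof.
move=> lc; exists setT; split=> // [|k]; first exact: openT.
have idk : Ckg k setT (@id U).
  case: k => [|k]; first by move=> y _; apply: cvg_id.
  split=> [y _|v]; first by apply: ex_diff.
  have -> : (fun y : U => 'd (@id U) y v) = (fun=> v); last exact: Ckg_cst.
  by apply/funext => y; rewrite diff_val.
exact: (Ckg_linear openT lc idk).
Qed.

Lemma smooth_germ_eq U W (f g : U -> W) x :
  (\forall y \near x, f y = g y) -> smooth_germ f x -> smooth_germ g x.
Proof.
move=> fg [Q [oO Ox fk]]; exists (Q `&` interior [set y | f y = g y]); split=> [||k].
- by apply: openI => //; apply: open_interior.
- by split.
- apply: (Ckg_eq (f := f)); first by apply: openI => //; apply: open_interior.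
    by move=> y [_ /interior_subset].
  by apply: Ckg_subset (fk k) => y [].
Qed.

Lemma smooth_germ_near U W (f : U -> W) (P : set U) x : nbhs x P ->
  smooth_germ f x -> exists Q, [/\ open Q, Q x, Q `<=` P & forall k, Ckg k Q f].
Proof.
move=> Px [Q [oO Ox fk]]; exists (Q `&` interior P); split=> [||y [_ /interior_subset]//|k].
- by apply: openI => //; apply: open_interior.
- by split.
- by apply: Ckg_subset (fk k) => y [].
Qed.

Lemma smooth_germ_forall U W (I : finType) (F : I -> U -> W) x :
  (forall i, smooth_germ (F i) x) ->
  exists Q, [/\ open Q, Q x & forall i k, Ckg k Q (F i)].
Proof.
move=> /(_ _)/cid => FO; pose N := [set y | forall i, sval (FO i) y].
have Nx : nbhs x N.
  apply: filter_forall => i; case: (FO i) => Q /= [oO Ox _].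
  exact: open_nbhs_nbhs.
exists (interior N); split=> // [|i k]; first exact: open_interior.
apply: (@Ckg_subset _ _ _ _ (sval (FO i))); first by move=> y /interior_subset.
by case: (FO i) => Q [].
Qed.

Lemma smooth_germ_mx U m n (F : U -> 'M[R]_(m, n)) x :
  smooth_germ F x <-> forall i j, smooth_germ (fun y => F y i j : R) x.
Proof.
split=> [[Q [oO Ox Fk]] i j|Fij].
  by exists Q; split=> // k; have /(Ckg_mx _ _ oO) := Fk k; apply.
have [ij|Q [oO Ox Fk]] := @smooth_germ_forall U R ('I_m * 'I_n)%type
    (fun ij y => F y ij.1 ij.2) x; first exact: Fij.
by exists Q; split=> // k; apply/(Ckg_mx _ _ oO) => i j; apply: (Fk (i, j)).
Qed.

Lemma smooth_germ_comp U n m p (f : U -> 'rV[R]_n) (g : 'rV[R]_n -> 'M[R]_(m, p)) x :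
  smooth_germ f x -> smooth_germ g (f x) -> smooth_germ (fun y => g (f y)) x.
Proof.
move=> fx [D [oD Dx gk]].
have [|Q [oO Ox OD fk]] := smooth_germ_near (P := f @^-1` D) _ fx.
  by apply: (smooth_germ_continuous fx); apply: open_nbhs_nbhs.
exists Q; split=> // k; apply/(Ckg_mx _ _ oO) => i j.
apply: (Ckg_comp oO oD OD (fk k) (g := fun z => g z i j)).
by have /(Ckg_mx _ _ oD) := gk k; apply.
Qed.

Lemma smooth_germI U W W' (f : U -> W) (g : U -> W') x :
  smooth_germ f x -> smooth_germ g x ->
  exists Q, [/\ open Q, Q x, forall k, Ckg k Q f & forall k, Ckg k Q g].
Proof.
move=> [Q [oO Ox fk]] [D [oD Dx gk]].
exists (Q `&` D); split=> // [|k|k]; first exact: openI.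
- by apply: Ckg_subset (fk k) => y [].
- by apply: Ckg_subset (gk k) => y [].
Qed.

Lemma smooth_germ_mulmx U m n p (F : U -> 'M[R]_(m, n)) (G : U -> 'M[R]_(n, p)) x :
  smooth_germ F x -> smooth_germ G x -> smooth_germ (fun y => F y *m G y) x.
Proof.
move=> Fx Gx; have [Q [oO Ox Fk Gk]] := smooth_germI Fx Gx.
by exists Q; split=> // k; apply: Ckg_mulmx.
Qed.

Lemma smooth_germ_trmx U m n (F : U -> 'M[R]_(m, n)) x :
  smooth_germ F x -> smooth_germ (fun y => (F y)^T) x.
Proof. by move=> [Q [oO Ox Fk]]; exists Q; split=> // k; apply: Ckg_trmx. Qed.

Lemma smooth_germ_invmx U n (F : U -> 'M[R]_n) x :
  (\forall y \near x, F y \in unitmx) -> smooth_germ F x ->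
  smooth_germ (fun y => invmx (F y)) x.
Proof.
move=> Fu /(smooth_germ_near Fu) [Q [oO Ox OF Fk]].
by exists Q; split=> // k; apply: Ckg_invmx.
Qed.

Lemma smooth_germ_sqrtmx U n (F : U -> 'M[R]_n) x :
  (\forall y \near x, posdefmx (F y)) -> smooth_germ F x ->
  smooth_germ (fun y => sqrtmx (F y)) x.
Proof.
move=> Fu /(smooth_germ_near Fu) [Q [oO Ox OF Fk]].
by exists Q; split=> // k; apply: Ckg_sqrtmx.
Qed.

(** [polarmx] is composed of products, transposes, inverses of invertible matrices and square roots
    of positive definite ones. *)
Lemma smooth_germ_polarmx U n (G G' A : U -> 'M[R]_n) x :
  (\forall y \near x, [/\ posdefmx (G y), posdefmx (G' y) & A y \in unitmx]) ->
  smooth_germ G x -> smooth_germ G' x -> smooth_germ A x ->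
  smooth_germ (fun y => polarmx (G y) (G' y) (A y)) x.
Proof.
move=> GGA Gx G'x Ax.
have Cx : smooth_germ (fun y => sqrtmx (G y)) x.
  by apply: smooth_germ_sqrtmx => //; apply: filterS GGA => y [].
have C'x : smooth_germ (fun y => sqrtmx (G' y)) x.
  by apply: smooth_germ_sqrtmx => //; apply: filterS GGA => y [].
have Cu : \forall y \near x, sqrtmx (G y) \in unitmx.
  by apply: filterS GGA => y [/sqrtmxP [/posdefmx_unit]].
have C'u : \forall y \near x, sqrtmx (G' y) \in unitmx.
  by apply: filterS GGA => y [_ /sqrtmxP [/posdefmx_unit]].
have Atx : smooth_germ (fun y => invmx (sqrtmx (G y)) *m A y *m sqrtmx (G' y)) x.
  by do 2?[apply: smooth_germ_mulmx => //]; apply: smooth_germ_invmx.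
have Atu : \forall y \near x, invmx (sqrtmx (G y)) *m A y *m sqrtmx (G' y) \in unitmx.
  near=> y; rewrite !unitmx_mul unitmx_inv; apply/andP; split; last by near: y.
  apply/andP; split; first by near: y.
  by near: y; apply: filterS GGA => y [].
rewrite /polarmx; apply: smooth_germ_mulmx; last exact: smooth_germ_invmx.
apply: smooth_germ_mulmx; first apply: smooth_germ_mulmx => //.
  apply: smooth_germ_sqrtmx; first by apply: filterS Atu => y /posdefmx_mulTr.
  by apply: smooth_germ_mulmx => //; apply: smooth_germ_trmx.
apply: smooth_germ_invmx; last exact: smooth_germ_trmx.
by apply: filterS Atu => y; rewrite unitmx_tr.
Unshelve. all: by end_near. Qed.

Lemma smooth_germ_row_mx U m n (f : U -> 'rV[R]_m) (g : U -> 'rV[R]_n) x :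
  smooth_germ f x -> smooth_germ g x -> smooth_germ (fun y => row_mx (f y) (g y)) x.
Proof.
move=> /smooth_germ_mx fx /smooth_germ_mx gx; apply/smooth_germ_mx => i j.
rewrite [i]ord1; under [X in smooth_germ X]eq_fun do rewrite mxE.
by case: (fintype.split j) => k.
Qed.

Lemma smooth_germ_lsubmx m n (x : 'rV[R]_(m + n)) :
  smooth_germ (fun y : 'rV[R]_(m + n) => lsubmx y) x.
Proof. exact/smooth_germ_linear/continuous_lsubmx. Qed.

Lemma smooth_germ_rsubmx m n (x : 'rV[R]_(m + n)) :
  smooth_germ (fun y : 'rV[R]_(m + n) => rsubmx y) x.
Proof. exact/smooth_germ_linear/continuous_rsubmx. Qed.
End Germs.

(** * Smooth maps between charted spaces *)

Section SmoothMaps.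
Context {R : realType}.
Implicit Types M N P : charted_space R.

(** These are the chart axioms of [is_manifold] short of compatibility, in a form that also applies
    to [euclid] and [prod_space], which are given as mere charted spaces. *)
Definition locally_euclidean M : Prop :=
  (forall c, @atlas R M c -> is_chart c) /\
  (forall x : M, exists2 c, atlas c & cdom c x).

Lemma manifold_locally_euclidean (M : manifold R) : locally_euclidean M.
Proof. by case: (manifoldP M) => _ []. Qed.

Lemma euclid_locally_euclidean n : locally_euclidean (euclid R n).
Proof.
split=> [c ->|x]; last by exists (Chart setT id id).
split=> //=; first exact: openT.
- by rewrite image_id; apply: openT.
- by move=> x _; apply: cvg_id.
- by move=> x _; apply: cvg_id.
Qed.

Lemma is_chart_nbhs (T : topologicalType) n (c : chart R T n) (x : T) :
  is_chart c -> cdom c x -> nbhs (cmap c x) (cmap c @` cdom c).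
Proof. by case=> _ oi _ _ _ cx; apply: open_nbhs_nbhs; split=> //; exists x. Qed.

Lemma is_chart_cinv (T : topologicalType) n (c : chart R T n) (x : T) (A : set T) :
  is_chart c -> cdom c x -> nbhs x A ->
  \forall y \near cmap c x, A (cinv c y).
Proof.
case=> _ _ cK _ ic cx Ax; have := ic (cmap c x) (imageP _ cx).
by rewrite /prop_for /continuous_at cK //; apply.
Qed.

Lemma is_chart_image_nbhs (T : topologicalType) n (c : chart R T n) (x : T) (A : set T) :
  is_chart c -> cdom c x -> nbhs x A -> nbhs (cmap c x) (cmap c @` (cdom c `&` A)).
Proof.
move=> cc cx Ax; near=> y.
have [z cz zy] : (cmap c @` cdom c) y by near: y; apply: is_chart_nbhs.
exists z => //; split=> //; have [_ _ cK _ _] := cc.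
by rewrite -(cK z cz) zy; near: y; apply: is_chart_cinv.
Unshelve. all: by end_near. Qed.

Lemma prod_locally_euclidean M N :
  locally_euclidean M -> locally_euclidean N -> locally_euclidean (prod_space M N).
Proof.
move=> [Mc Mx] [Nc Nx]; split=> [_ [c [d [cM dN ->]]]|[x y]]; last first.
  have [c cM cx] := Mx x; have [d dN dy] := Nx y.
  by exists (prod_chart c d) => //; exists c, d.
have cc := Mc c cM; have dd := Nc d dN.
have [oc ic cK ccont icont] := cc; have [od id' dK dcont idcont] := dd.
have lc (z : 'rV[R]_(dim M + dim N)) : {for z, continuous lsubmx}.
  exact: continuous_lsubmx.
have rc (z : 'rV[R]_(dim M + dim N)) : {for z, continuous rsubmx}.
  exact: continuous_rsubmx.
split=> /=.
- rewrite openE => -[x y] [/= cx dy]; exists (cdom c, cdom d) => //=.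
  by split; apply: open_nbhs_nbhs.
- have -> : (fun z : M * N => row_mx (cmap c z.1) (cmap d z.2)) @` (cdom c `*` cdom d)
      = (lsubmx @^-1` (cmap c @` cdom c)) `&` (rsubmx @^-1` (cmap d @` cdom d)).
    apply/seteqP; split=> [_ [[x y] /= [cx dy] <-]|z [[x cx xz] [y dy yz]]].
      by rewrite /preimage /= row_mxKl row_mxKr; split; [exists x|exists y].
    by exists (x, y) => //=; rewrite xz yz hsubmxK.
  apply: openI; apply: open_comp => // z _; [exact: lc|exact: rc].
- by move=> [x y] [/= cx dy]; rewrite row_mxKl row_mxKr cK // dK.
- move=> [x y] [/= cx dy]; apply: continuous_mx => i j.
  rewrite [i]ord1; under [X in {for _, continuous X}]eq_fun do rewrite mxE.
  case: (fintype.split j) => k.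
    apply: (@continuous_comp _ _ _ (fun z : M * N => cmap c z.1)
      (fun A : 'rV[R]_(dim M) => A 0 k)); last exact: coord_continuous.
    by apply: (@continuous_comp _ _ _ fst (cmap c)); [exact: cvg_fst|apply: ccont].
  apply: (@continuous_comp _ _ _ (fun z : M * N => cmap d z.2)
    (fun A : 'rV[R]_(dim N) => A 0 k)); last exact: coord_continuous.
  by apply: (@continuous_comp _ _ _ snd (cmap d)); [exact: cvg_snd|apply: dcont].
- move=> _ [[x y] [/= cx dy] <-]; set z := row_mx _ _.
  have lz : {for z, continuous (fun w => cinv c (lsubmx w))}.
    apply: (@continuous_comp _ _ _ lsubmx (cinv c)); first exact: lc.
    by rewrite /z row_mxKl; apply: icont; exists x.
  have rz : {for z, continuous (fun w => cinv d (rsubmx w))}.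
    apply: (@continuous_comp _ _ _ rsubmx (cinv d)); first exact: rc.
    by rewrite /z row_mxKr; apply: idcont; exists y.
  exact: cvg_pair lz rz.
Qed.

(** Asking for all charts around [x] and [f x], as [smooth_on] does, lets two maps be composed
    through any chart of the middle space. *)
Definition smooth_at M N (f : M -> N) (x : M) : Prop :=
  {for x, continuous f} /\
  forall c d, @atlas R M c -> @atlas R N d -> cdom c x -> cdom d (f x) ->
    smooth_germ (cmap d \o f \o cinv c) (cmap c x).

Lemma smooth_on_at M N (A : set M) (f : M -> N) x :
  locally_euclidean M -> locally_euclidean N -> open A -> A x ->
  smooth_on A f -> smooth_at f x.
Proof.
move=> [Mc _] [Nc _] oA Ax [fc fs]; split=> [|c d cM dN cx dfx]; first exact: fc.
apply: smooth_germ_Cinfty (fs c d cM dN); last by exists x.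
rewrite openE => _ [z [[cz Az] dz] <-]; rewrite /interior /= -setIA.
apply: is_chart_image_nbhs (Mc c cM) cz _; apply: filterI.
  exact: open_nbhs_nbhs.
by apply: (fc z Az); apply: open_nbhs_nbhs; split=> //; have [] := Nc d dN.
Qed.

Lemma smooth_at_on M N (A : set M) (f : M -> N) : locally_euclidean M ->
  (forall x, A x -> smooth_at f x) -> smooth_on A f.
Proof.
move=> [Mc _] fA; split=> [x /fA[]//|c d cM dN].
by apply: Cinfty_smooth_germ => _ [x [[cx Ax] dx] <-]; apply: (fA x Ax).2.
Qed.

Lemma smooth_at_eq M N (f g : M -> N) x : locally_euclidean M ->
  (\forall y \near x, f y = g y) -> smooth_at f x -> smooth_at g x.
Proof.
move=> [Mc _] fg [fc fs]; have fgx := nbhs_singleton fg; split.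
  suff : g @ x --> g x by [].
  by rewrite -fgx; apply: cvg_trans fc; apply: near_eq_cvg; apply: filterS fg => y ->.
move=> c d cM dN cx; rewrite -fgx => dx.
apply: smooth_germ_eq (fs c d cM dN cx dx).
by apply: filterS (is_chart_cinv (Mc c cM) cx fg) => y /= ->.
Qed.

Lemma smooth_at_comp M N P (f : M -> N) (g : N -> P) x :
  locally_euclidean M -> locally_euclidean N ->
  smooth_at f x -> smooth_at g (f x) -> smooth_at (g \o f) x.
Proof.
move=> [Mc _] [Nc Nx] [fc fs] [gc gs]; split; first exact: continuous_comp.
move=> c d cM dP cx dx; have [e eN ex] := Nx (f x).
have [_ _ cK _ _] := Mc c cM; have [oe _ eK _ _] := Nc e eN.
have gx : smooth_germ (fun y => (cmap d \o g \o cinv e) ((cmap e \o f \o cinv c) y))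
    (cmap c x).
  apply: smooth_germ_comp; first exact: fs.
  by rewrite /= cK //; apply: gs.
apply: smooth_germ_eq gx.
have fe : nbhs x (f @^-1` cdom e) by apply: fc; apply: open_nbhs_nbhs.
by apply: filterS (is_chart_cinv (Mc c cM) cx fe) => y /= ey; rewrite /= eK.
Qed.

(** In charts the first component is a transition map, so compatibility of the charts of [M] is what
    makes it smooth. *)
Lemma smooth_at_pairc (M : manifold R) N (p : N) (x : M) :
  @smooth_at M (prod_space M N) (fun x => (x, p)) x.
Proof.
split; first by apply: cvg_pair; [exact: cvg_id|exact: cvg_cst].
move=> c _ cM [c' [d [c'M dN ->]]] cx [/= c'x dp].
apply: (@smooth_germ_row_mx _ _ _ _ (cmap c' \o cinv c) (fun=> cmap d p));
  last exact: smooth_germ_cst.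
have [_ [Mc _ Mt]] := manifoldP M; have [oc' _ _ _ _] := Mc c' c'M.
have [oc _ _ _ _] := Mc c cM.
apply: smooth_germ_Cinfty (Mt c c' cM c'M); last by exists x.
rewrite openE => _ [z [cz c'z] <-]; rewrite /interior /=.
by apply: is_chart_image_nbhs (Mc c cM) cz _; apply: open_nbhs_nbhs.
Qed.

Lemma smooth_at_snd_euclid M n (z : prod_space M (euclid R n)) :
  @smooth_at (prod_space M (euclid R n)) (euclid R n) snd z.
Proof.
split; first exact: cvg_snd.
move=> _ _ [c [_ [cM -> ->]]] -> _ _ /=.
exact: smooth_germ_rsubmx.
Qed.

Lemma smooth_at_euclid_germ M n (f : M -> euclid R n) x : smooth_at f x ->
  forall c, @atlas R M c -> cdom c x ->
  smooth_germ (fun y => f (cinv c y) : 'rV[R]_n) (cmap c x).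
Proof. by move=> [_ fs] c cM cx; apply: (fs c (Chart setT id id)). Qed.

Lemma chart_smooth_continuous M (W : normedModType R) (f : M -> W) c x :
  @atlas R M c -> is_chart c -> cdom c x ->
  smooth_germ (fun y => f (cinv c y)) (cmap c x) -> {for x, continuous f}.
Proof.
move=> cM [oc _ cK cc _] cx /smooth_germ_continuous fc.
have fcx : {for x, continuous ((fun y => f (cinv c y)) \o cmap c)}.
  by apply: continuous_comp => //; apply: cc.
suff : f @ x --> f x by [].
rewrite -{2}(cK x cx); apply: cvg_trans fcx; apply: near_eq_cvg.
by apply: filterS (open_nbhs_nbhs (conj oc cx)) => y cy /=; rewrite cK.
Qed.
End SmoothMaps.

(** * Metric bundles in local coordinates *)

Section LocalCoordinates.
Variables (R : realType) (M : manifold R) (V : vector_bundle M).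
Variables (U : set M) (t : V -> euclid R (rank V))
  (s : prod_space M (euclid R (rank V)) -> V).
Hypothesis tUs : @local_trivialization R M V (rank V) U t s.

(** This form of [incl_surj] lets the base point be only provably equal to [proj v], which avoids
    casts between fibres. *)
Lemma fibre_incl (v : V) x : proj v = x -> exists e : fibre V x, incl e = v.
Proof. by case: x /; apply: incl_surj. Qed.

Lemma coord_linear x : U x -> linear ((fun e => t (incl e)) : fibre V x -> 'rV[R]_(rank V)).
Proof. by case: tUs => _ [_ _]; apply. Qed.

Lemma coord_inj x : U x -> injective (fun e : fibre V x => t (incl e)).
Proof.
move=> Ux e e' tee'; apply: (@incl_inj _ _ V); have [[_ st _] _] := tUs.
have sE (f : fibre V x) : s (x, t (incl f)) = incl f :> V.
  by have := st (incl f); rewrite proj_incl => /(_ Ux).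
by rewrite -(sE e) -(sE e'); congr (s (x, _)).
Qed.

Lemma coord_surj x (a : 'rV[R]_(rank V)) : U x ->
  exists e : fibre V x, incl e = s (x, a) /\ t (incl e) = a.
Proof.
move=> Ux; have [[_ _ /(_ x a Ux) [px ta]] _] := tUs.
have [e es] := fibre_incl px; by exists e; rewrite es; split.
Qed.

(** This is the inverse of [t] on the fibre over [x]. It is extracted by choice, as [s] takes its
    values in the total space and not in a fibre. *)
Definition fibre_vec x (Ux : U x) (a : 'rV[R]_(rank V)) : fibre V x :=
  sval (cid (coord_surj a Ux)).

Lemma incl_fibre_vec x (Ux : U x) a : incl (fibre_vec Ux a) = s (x, a).
Proof. by rewrite /fibre_vec; case: cid => e []. Qed.

Lemma coord_fibre_vec x (Ux : U x) a : t (incl (fibre_vec Ux a)) = a.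
Proof. by rewrite /fibre_vec; case: cid => e []. Qed.

Lemma fibre_vec_coord x (Ux : U x) e : fibre_vec Ux (t (incl e)) = e.
Proof. by apply: (coord_inj Ux); rewrite coord_fibre_vec. Qed.

Lemma fibre_vec_is_linear x (Ux : U x) : linear (fibre_vec Ux).
Proof.
move=> k a b; apply: (coord_inj Ux).
by rewrite (coord_linear Ux) !coord_fibre_vec.
Qed.
HB.instance Definition _ x (Ux : U x) :=
  GRing.isLinear.Build R 'rV[R]_(rank V) (fibre V x) _ (fibre_vec Ux)
    (fibre_vec_is_linear Ux).

(* Dependence on [tUs] is what lets the linear structure below be inferred. *)
#[using="tUs"]
Definition fibre_coord x (Ux : U x) (e : fibre V x) : 'rV[R]_(rank V) := t (incl e).

Lemma fibre_coord_is_linear x (Ux : U x) : linear (fibre_coord Ux).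
Proof. exact: coord_linear. Qed.
HB.instance Definition _ x (Ux : U x) :=
  GRing.isLinear.Build R (fibre V x) 'rV[R]_(rank V) _ (fibre_coord Ux)
    (fibre_coord_is_linear Ux).

Lemma fibre_vecK x (Ux : U x) : cancel (fibre_vec Ux) (fibre_coord Ux).
Proof. by move=> a; apply: coord_fibre_vec. Qed.

Lemma fibre_coordK x (Ux : U x) : cancel (fibre_coord Ux) (fibre_vec Ux).
Proof. by move=> e; apply: fibre_vec_coord. Qed.

Variable g : bundle_metric V.

Definition gram x (Ux : U x) : 'M[R]_(rank V) :=
  \matrix_(i, j) g x (fibre_vec Ux (delta_mx 0 i)) (fibre_vec Ux (delta_mx 0 j)).

Lemma form_fibre_vec x (Ux : U x) e (b : 'rV[R]_(rank V)) :
  g x e (fibre_vec Ux b) = \sum_j b 0 j * g x e (fibre_vec Ux (delta_mx 0 j)).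
Proof.
pose glM := GRing.isLinear.Build R (fibre V x) R *%R (g x e) (form_linear g e).
pose gl : {linear fibre V x -> R | *%R} := HB.pack (g x e) glM.
rewrite -[g x e]/(gl : _ -> _) [in LHS](row_sum_delta b) linear_sum linear_sum.
by apply: eq_bigr => j _; rewrite linearZ linearZ.
Qed.

Lemma form_gram x (Ux : U x) (a b : 'rV[R]_(rank V)) :
  g x (fibre_vec Ux a) (fibre_vec Ux b) = (a *m gram Ux *m b^T) 0 0.
Proof.
rewrite form_fibre_vec mxE; apply: eq_bigr => j _.
rewrite form_sym form_fibre_vec mxE [RHS]mulrC mxE; congr (_ * _).
by apply: eq_bigr => i _; rewrite !mxE form_sym.
Qed.

Lemma gram_posdef x (Ux : U x) : posdefmx (gram Ux).
Proof.
split; first by apply/matrixP => i j; rewrite !mxE form_sym.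
move=> v v0; rewrite -form_gram form_posdef //.
by apply: contra_neq v0 => v0; rewrite -[v](fibre_vecK Ux) v0 linear0.
Qed.

End LocalCoordinates.

Lemma bilinear_mx_eq (R : realType) n (X Y : 'M[R]_n) :
  (forall a b : 'rV_n, (a *m X *m b^T) 0 0 = (a *m Y *m b^T) 0 0) -> X = Y.
Proof.
move=> XY; apply/matrixP => i j.
pose e k : 'rV[R]_n := delta_mx 0 k.
have E (Z : 'M[R]_n) : Z i j = (e i *m Z *m (e j)^T) 0 0.
  by rewrite trmx_delta -rowE -colE !mxE.
by rewrite E XY -E.
Qed.

Lemma bilinear_mx_tr (R : realType) n (X : 'M[R]_n) (a b : 'rV_n) :
  (a *m X *m b^T) 0 0 = (b *m X^T *m a^T) 0 0.
Proof.
have -> : b *m X^T *m a^T = (a *m X *m b^T)^T by rewrite !trmx_mul trmxK mulmxA.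
by rewrite [RHS]mxE.
Qed.

(** With [T^*] the adjoint of [T], the last two conditions say that [T^* L] is symmetric and
    positive definite, so that [L = T (T^* L)] is the polar decomposition of [L]; no coordinates or
    choices enter. *)
Definition polar_part (R : realType) (M : manifold R) (V : vector_bundle M)
    (g : bundle_metric V) (x y : M) (L T : fibre V x -> fibre V y) : Prop :=
  [/\ forall a b, g y (T a) (T b) = g x a b,
      forall a b, g y (T a) (L b) = g y (T b) (L a)
    & forall a, a != 0 -> 0 < g y (T a) (L a)].

(** * Linear maps between fibres as matrices *)

Section Transport.
Variables (R : realType) (M : manifold R) (V : vector_bundle M) (g : bundle_metric V).
Variables (U U' : set M) (t t' : V -> euclid R (rank V))
  (s s' : prod_space M (euclid R (rank V)) -> V).
Hypothesis tUs : @local_trivialization R M V (rank V) U t s.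
Hypothesis tUs' : @local_trivialization R M V (rank V) U' t' s'.
Variables (x y : M) (Ux : U x) (Uy : U' y).
Implicit Types L T : {linear fibre V x -> fibre V y}.

Local Notation G := (gram tUs g Ux).
Local Notation G' := (gram tUs' g Uy).

Definition coordmx L : 'M[R]_(rank V) :=
  lin1_mx (fibre_coord tUs' Uy \o L \o fibre_vec tUs Ux).

Lemma coordmxE L a : L (fibre_vec tUs Ux a) = fibre_vec tUs' Uy (a *m coordmx L).
Proof. by rewrite mul_rV_lin1 /= fibre_coordK. Qed.

Lemma form_coordmx T L a b :
  g y (T (fibre_vec tUs Ux a)) (L (fibre_vec tUs Ux b)) =
    (a *m (coordmx T *m G' *m (coordmx L)^T) *m b^T) 0 0.
Proof. by rewrite !coordmxE form_gram trmx_mul !mulmxA. Qed.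

Lemma coordmx_unit L : injective L -> coordmx L \in unitmx.
Proof.
move=> Linj; rewrite -row_free_unit; apply: inj_row_free => a aL0.
rewrite -[a](fibre_vecK tUs Ux).
suff -> : fibre_vec tUs Ux a = 0 by rewrite linear0.
by apply: Linj; rewrite coordmxE aL0 !linear0.
Qed.

(** This is the uniqueness of the orthogonal factor read in coordinates: it turns the intrinsic
    polar part into an explicit function of [L] and the Gram matrices. *)
Lemma polar_part_coordmx L T : injective L -> polar_part g L T ->
  coordmx T = polarmx G G' (coordmx L).
Proof.
move=> Linj [iso symT posT].
apply: polarmx_unique; [exact: gram_posdef|exact: gram_posdef|exact: coordmx_unit| |].
  by apply: bilinear_mx_eq => a b; rewrite -form_coordmx iso form_gram.
split=> [|v v0].
  apply: bilinear_mx_eq => a b; rewrite -bilinear_mx_tr -form_coordmx symT.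
  by rewrite form_coordmx.
rewrite -form_coordmx posT //; apply: contra_neq v0 => v0.
by rewrite -[v](fibre_vecK tUs Ux) v0 linear0.
Qed.

Lemma polar_part_exists L : injective L ->
  exists2 T : {linear fibre V x -> fibre V y}, bijective T & polar_part g L T.
Proof.
move=> Linj; have Au := coordmx_unit Linj.
have Gpd := gram_posdef tUs g Ux; have G'pd := gram_posdef tUs' g Uy.
have [BB BA] := polarmxP Gpd G'pd Au.
set B := polarmx _ _ _ in BB BA.
(* [B] is a left factor of the invertible matrix [G]. *)
have Bu : B \in unitmx.
  by have := posdefmx_unit Gpd; rewrite -BB -mulmxA unitmx_mul => /andP[].
pose T : {linear fibre V x -> fibre V y} :=
  fibre_vec tUs' Uy \o (mulmxr B \o fibre_coord tUs Ux).
have TE : coordmx T = B.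
  apply/row_matrixP => i; rewrite !rowE mul_rV_lin1 /=.
  by rewrite !fibre_vecK.
have Tbij : bijective T.
  exists (fun e => fibre_vec tUs Ux (fibre_coord tUs' Uy e *m invmx B)) => e /=.
    by rewrite fibre_vecK mulmxK // fibre_coordK.
  by rewrite fibre_vecK mulmxKV // fibre_coordK.
clearbody T; exists T => //; have [BAt BApos] := BA; split.
- move=> a b; rewrite -[a](fibre_coordK tUs Ux) -[b](fibre_coordK tUs Ux).
  by rewrite form_coordmx TE BB -form_gram.
- move=> a b; rewrite -[a](fibre_coordK tUs Ux) -[b](fibre_coordK tUs Ux).
  by rewrite !form_coordmx TE [LHS]bilinear_mx_tr BAt.
- move=> a a0; rewrite -[a](fibre_coordK tUs Ux) form_coordmx TE.
  apply: BApos; apply: contra_neq a0 => a0.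
  by rewrite -[a](fibre_coordK tUs Ux) a0 linear0.
Qed.
End Transport.

Lemma open_setXT (S T : topologicalType) (A : set S) : open A -> open (A `*` [set: T]).
Proof.
move=> oA; rewrite openE => -[x y] [/= Ax _]; exists (A, setT) => //=.
by split; [apply: open_nbhs_nbhs|apply: filterT].
Qed.

(** * Smoothness of the polar part of a smooth bundle map *)

Section PolarSmooth.
Variables (R : realType) (M : manifold R) (V : vector_bundle M) (g : bundle_metric V).
Local Notation E := (euclid R (rank V)).
Local Notation ME := (prod_space M E).

Lemma open_proj_preimage (U : set M) : open U -> open (@proj R M V @^-1` U).
Proof. by move=> oU; apply: open_comp => // v _; apply: (proj_smooth V).1. Qed.

Section Chart.
Variables (U : set M) (t : V -> E) (s : ME -> V).
Hypothesis tUs : @local_trivialization R M V (rank V) U t s.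

Lemma trivialization_smooth (v : V) : U (proj v) ->
  @smooth_at R V ME (fun v => (proj v, t v)) v.
Proof.
have [[oU _ _] [ts _ _]] := tUs => Uv.
apply: smooth_on_at ts => //; first exact: manifold_locally_euclidean.
  apply: prod_locally_euclidean; [exact: manifold_locally_euclidean|].
  exact: euclid_locally_euclidean.
exact: open_proj_preimage.
Qed.

Lemma section_smooth (x : M) (a : E) : U x -> @smooth_at R ME V s (x, a).
Proof.
have [[oU _ _] [_ ss _]] := tUs => Ux.
apply: smooth_on_at ss => //; last exact: open_setXT.
  apply: prod_locally_euclidean; [exact: manifold_locally_euclidean|].
  exact: euclid_locally_euclidean.
exact: manifold_locally_euclidean.
Qed.

(** [gram] takes a proof that [x] lies in [U], whereas smoothness concerns total functions. The form
    [h] in coordinates, evaluated at constant basis vectors, provides one. *)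
Lemma gram_smooth : exists G : M -> 'M[R]_(rank V),
  (forall x (Ux : U x), gram tUs g Ux = G x) /\
  forall i j x, U x -> @smooth_at R M (euclid R 1) (fun x => (G x i j)%:M) x.
Proof.
have [h [gh hs]] := form_smooth g tUs.
pose e k : E := delta_mx 0 k : 'rV[R]_(rank V).
exists (fun x => \matrix_(i, j) h (x, (e i, e j))); split=> [x Ux|i j x Ux].
  by apply/matrixP => i j; rewrite !mxE gh // !coord_fibre_vec.
pose f (x : M) : prod_space M (prod_space E E) := (x, (e i, e j)).
pose k (z : prod_space M (prod_space E E)) : euclid R 1 := ((h z)%:M : 'rV[R]_1).
have Mle := manifold_locally_euclidean M.
apply: (smooth_at_eq (f := k \o f)) => //; first by apply: filterE => y; rewrite mxE.
apply: smooth_at_comp => //.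
- apply: prod_locally_euclidean => //.
  by apply: prod_locally_euclidean; apply: euclid_locally_euclidean.
- exact: smooth_at_pairc.
apply: smooth_on_at hs => //; last first.
- by apply: open_setXT; have [[]] := tUs.
- exact: euclid_locally_euclidean.
apply: prod_locally_euclidean; [exact: manifold_locally_euclidean|].
by apply: prod_locally_euclidean; apply: euclid_locally_euclidean.
Qed.
End Chart.

Variables (Phi Psi : V -> V) (phi : M -> M).
Hypothesis Phis : smooth_on setT Phi.
Hypothesis phis : smooth_on setT phi.
Hypothesis PhiPsi : forall x, exists L T : {linear fibre V x -> fibre V (phi x)},
  [/\ injective L, restricts_to Phi L, restricts_to Psi T & polar_part g L T].

Let Mle : locally_euclidean M := manifold_locally_euclidean M.
Let Vle : locally_euclidean V := manifold_locally_euclidean (total V).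
Let Ele : locally_euclidean E := euclid_locally_euclidean (rank V).
Let MEle : locally_euclidean ME := prod_locally_euclidean Mle Ele.

(** Near [v0], [Psi] is the composite of a trivialization, of [H (x, a) = (phi x, a *m B x)] and of
    the inverse [s'] of a second trivialization. *)
Lemma polar_part_smooth : smooth_on setT Psi.
Proof.
apply: smooth_at_on => // v0 _; set x0 := proj v0.
have Phis' v : smooth_at Phi v by apply: smooth_on_at Phis => //; apply: openT.
have phis' x : smooth_at phi x by apply: smooth_on_at phis => //; apply: openT.
have [U [t [s [Ux0 tUs]]]] := locally_trivial V x0.
have [U' [t' [s' [U'x0 tUs']]]] := locally_trivial V (phi x0).
have [G [GE Gs]] := gram_smooth tUs; have [G' [G'E G's]] := gram_smooth tUs'.
have [[oU st ts] _] := tUs; have [[oU' st' ts'] _] := tUs'.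
pose e k : E := delta_mx 0 k : 'rV[R]_(rank V).
(* Row [i] is the image of the basis vector [e i] under [Phi]. Like [G] and [G'], [A] is total, but
   has its meaning only over [W]. *)
pose A x : 'M[R]_(rank V) := \matrix_i (t' (Phi (s (x, e i))) : 'rV[R]_(rank V)).
pose B x := polarmx (G x) (G' (phi x)) (A x).
pose W := [set x | U x /\ U' (phi x)].
have oW : open W.
  by apply: openI => //; apply: open_comp => // x _; apply: phis.1.
have Wx0 : W x0 by [].
(* Over [W], [A] is the matrix of [Phi], so uniqueness of the polar part makes [B] the matrix of
   [Psi]. *)
have coordE x : W x -> [/\ posdefmx (G x), posdefmx (G' (phi x)), A x \in unitmx
    & forall v, proj v = x -> proj (Psi v) = phi x /\ t' (Psi v) = t v *m B x].
  move=> [Ux U'x]; have [L [T [Linj PhiL PsiT LT]]] := PhiPsi x.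
  have AE : coordmx tUs tUs' Ux U'x L = A x.
    apply/row_matrixP => i; rewrite rowK rowE mul_rV_lin1 /= /fibre_coord.
    by rewrite -PhiL incl_fibre_vec.
  have TE := polar_part_coordmx tUs tUs' Ux U'x Linj LT.
  split.
  - by rewrite -(GE _ Ux); apply: gram_posdef.
  - by rewrite -(G'E _ U'x); apply: gram_posdef.
  - by rewrite -AE; apply: coordmx_unit.
  move=> v vx; have [a av] := fibre_incl vx; rewrite -av PsiT proj_incl; split=> //.
  rewrite -[a in LHS](fibre_coordK tUs Ux) (coordmxE tUs tUs' Ux U'x T).
  by rewrite coord_fibre_vec TE AE GE G'E.
have Bgerm c : @atlas R M c -> cdom c x0 ->
    smooth_germ (fun y => B (cinv c y)) (cmap c x0).
  move=> cM cx0.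
  apply: smooth_germ_polarmx.
  - have cW := is_chart_cinv (Mle.1 c cM) cx0 (open_nbhs_nbhs (conj oW Wx0)).
    by apply: filterS cW => y /coordE [].
  - apply/smooth_germ_mx => i j.
    have /smooth_germ_mx /(_ 0 0) := smooth_at_euclid_germ (Gs i j x0 Ux0) cM cx0.
    by apply: smooth_germ_eq; apply: filterE => y; rewrite mxE mulr1n.
  - apply/smooth_germ_mx => i j.
    have G's0 := smooth_at_comp Mle Mle (phis' x0) (G's i j _ U'x0).
    have /smooth_germ_mx /(_ 0 0) := smooth_at_euclid_germ G's0 cM cx0.
    by apply: smooth_germ_eq; apply: filterE => y; rewrite /= mxE mulr1n.
  - apply/smooth_germ_mx => i j.
    (* The rows of [A] are smooth as composites: a constant section in the first trivialization,
       then [Phi], then the coordinate of the second trivialization. *)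
    have tPs : @smooth_at R M E (snd \o ((fun v => (proj v, t' v)) \o
        (Phi \o (s \o (fun x => (x, e i)))))) x0.
      have U'Phi : U' (proj (Phi (s (x0, e i)))).
        have [L [_ [_ PhiL _ _]]] := PhiPsi x0.
        by rewrite -(incl_fibre_vec tUs Ux0) PhiL proj_incl.
      have p1 := smooth_at_pairc (M := M) (e i) x0.
      have p2 := smooth_at_comp Mle MEle p1 (section_smooth tUs (e i) Ux0).
      have p3 := smooth_at_comp Mle Vle p2 (Phis' _).
      have p4 := smooth_at_comp Mle Vle p3 (trivialization_smooth tUs' U'Phi).
      exact: smooth_at_comp Mle MEle p4 (smooth_at_snd_euclid _).
    have /smooth_germ_mx /(_ 0 j) := smooth_at_euclid_germ tPs cM cx0.
    by apply: smooth_germ_eq; apply: filterE => y; rewrite mxE.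
pose H (z : ME) : ME := (phi z.1, z.2 *m B z.1).
have H2germ c : @atlas R M c -> cdom c x0 ->
    smooth_germ (fun y => rsubmx y *m B (cinv c (lsubmx y))) (row_mx (cmap c x0) (t v0)).
  move=> cM cx0; apply: smooth_germ_mulmx; first exact: smooth_germ_rsubmx.
  apply: (smooth_germ_comp (g := fun y => B (cinv c y))); first exact: smooth_germ_lsubmx.
  by rewrite row_mxKl; apply: Bgerm.
have Hs : smooth_at H (x0, t v0).
  split.
    have H1c : {for (x0, t v0), continuous (fun z : ME => phi z.1)}.
      by apply: (@continuous_comp _ _ _ fst phi); [exact: cvg_fst|exact: phis.1].
    have H2c : {for (x0, t v0), continuous (fun z : ME => z.2 *m B z.1 : 'rV[R]_(rank V))}.
      (* Continuity is a separate requirement of [smooth_at]; it follows from smoothness in a single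
         chart of the product. *)
      have [c cM cx0] := Mle.2 x0.
      pose cE := prod_chart c (Chart setT id id : chart R E _).
      have cEM : @atlas R ME cE by exists c, (Chart setT id id).
      by apply: (chart_smooth_continuous cEM (MEle.1 cE cEM)) => //; apply: H2germ.
    exact: cvg_pair H1c H2c.
  move=> _ _ [c [_ [cM -> ->]]] [d [_ [dM -> ->]]] [/= cx0 _] [/= dx0 _].
  apply: (smooth_germ_row_mx (f := fun y => (cmap d \o phi \o cinv c) (lsubmx y))
    (g := fun y => rsubmx y *m B (cinv c (lsubmx y)))); last exact: H2germ.
  apply: smooth_germ_comp; first exact: smooth_germ_lsubmx.
  by rewrite row_mxKl; apply: (phis' x0).2.
have PsiE : \forall v \near v0, s' (H (proj v, t v)) = Psi v.
  have oWV : open (@proj R M V @^-1` W) by apply: open_proj_preimage.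
  apply: filterS (open_nbhs_nbhs (conj oWV Wx0)) => v Wv.
  have [_ _ _ /(_ v erefl) [pv tv]] := coordE _ Wv.
  by rewrite /H /= -pv -tv st' // pv; have [] := Wv.
apply: (smooth_at_eq Vle PsiE).
apply: (smooth_at_comp (g := s' \o H) Vle MEle).
  exact: (trivialization_smooth tUs).
by apply: smooth_at_comp => //; apply: (section_smooth tUs').
Qed.
End PolarSmooth.

(** * Polar parts assembled into a bundle isometry *)

Section Assembly.
Variables (R : realType) (M : manifold R) (V : vector_bundle M) (g : bundle_metric V).

Lemma linear_bij_inverse (A B : lmodType R) (L : {linear A -> B}) : bijective L ->
  exists K : {linear B -> A}, cancel L K /\ cancel K L.
Proof.
case=> K LK KL; have Klin : linear K.
  by move=> a u v; apply: (can_inj LK); rewrite KL linearP !KL.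
pose KM := GRing.isLinear.Build R B A _ K Klin.
by exists (HB.pack K KM : {linear B -> A}).
Qed.

Lemma total_of_fibrewise (phi : M -> M) (T : forall x, fibre V x -> fibre V (phi x)) :
  exists Psi : V -> V, forall x, restricts_to Psi (T x).
Proof.
pose vec (v : V) : fibre V (proj v) := sval (cid (incl_surj v)).
have vecK v : incl (vec v) = v by rewrite /vec; case: cid.
exists (fun v => incl (T _ (vec v))) => x a.
have : incl (vec (incl a)) = incl a by [].
(* The vector lies in the fibre over [proj (incl a)], which is only provably [x]; once it is
   generalized, the base point can be rewritten. *)
move: (vec (incl a)); rewrite proj_incl => b ba.
by rewrite (incl_inj ba).
Qed.

(** Since [T] is isometric, the form pairing [S] with [K] is the pullback along [K] of the one
    pairing [T] with [L], and inherits symmetry and positivity. *)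
Lemma polar_part_inverse x y (L T : {linear fibre V x -> fibre V y})
    (K S : {linear fibre V y -> fibre V x}) :
  cancel L K -> cancel K L -> cancel T S -> cancel S T ->
  polar_part g L T -> polar_part g K S.
Proof.
move=> LK KL TS ST [iso symT posT].
have isoS a b : g x (S a) (S b) = g y a b by rewrite -iso !ST.
have SK a b : g x (S a) (K b) = g y (T (K b)) (L (K a)).
  by rewrite -iso ST KL form_sym.
split=> // [a b|a a0]; first by rewrite !SK symT.
by rewrite SK posT //; apply: contra_neq a0 => Ka0; rewrite -[a]KL Ka0 linear0.
Qed.

Lemma automorphism_lift_linear (Phi : V -> V) (phi : M -> M) x :
  automorphism Phi -> lifts Phi phi ->
  exists L : {linear fibre V x -> fibre V (phi x)}, bijective L /\ restricts_to Phi L.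
Proof.
move=> [_ /(_ x) [y [L [Lbij PhiL]]]] Pp.
suff yE : y = phi x by move: L Lbij PhiL; rewrite yE => L; exists L.
(* The zero vector provides a point of the fibre at which the two base points can be compared. *)
by have := Pp (incl (0 : fibre V x)); rewrite PhiL !proj_incl.
Qed.

Lemma bundle_polar_part_exists x y (L : {linear fibre V x -> fibre V y}) : injective L ->
  exists2 T : {linear fibre V x -> fibre V y}, bijective T & polar_part g L T.
Proof.
have [U [t [s [Ux tUs]]]] := locally_trivial V x.
have [U' [t' [s' [Uy tUs']]]] := locally_trivial V y.
exact: (polar_part_exists g tUs tUs' Ux Uy).
Qed.

End Assembly.

Theorem proposition12 (R : realType) (M : manifold R) (V : vector_bundle M)
    (g : bundle_metric V) (phi : M -> M) (hphi : diffeomorphism phi) :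
  (exists Phi : V -> V, automorphism Phi /\ lifts Phi phi) <->
  (exists Phi : V -> V, isometry_lifting g Phi phi).
Proof.
split=> [[Phi [PhiA Pp]]|[Phi [PhiA Pp _]]]; last by exists Phi.
have [phis [phi' [phiK phi'K phi's]]] := hphi.
have [[Phis [Phi' [PhiK Phi'K Phi's]]] _] := PhiA.
(* [L] and [T] are packed as a pair so that a single choice selects both. *)
have LT x : exists LT : {linear fibre V x -> fibre V (phi x)}
    * {linear fibre V x -> fibre V (phi x)},
  [/\ bijective LT.1, bijective LT.2, restricts_to Phi LT.1 & polar_part g LT.1 LT.2].
  have [L [Lbij PhiL]] := automorphism_lift_linear x PhiA Pp.
  have [T Tbij LT] := bundle_polar_part_exists g (bij_inj Lbij).
  by exists (L, T).
have [Psi PsiT] := total_of_fibrewise (fun x => (sval (cid (LT x))).2).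
have {PsiT LT} LT x : exists L T : {linear fibre V x -> fibre V (phi x)},
    [/\ bijective L, bijective T, restricts_to Phi L, restricts_to Psi T & polar_part g L T].
  have := PsiT x; case: cid => -[L T] /= [Lbij Tbij PhiL pLT] PsiT'.
  by exists L, T.
have Psis : smooth_on setT Psi.
  apply: (polar_part_smooth (g := g) Phis phis) => x.
  have [L [T [/bij_inj Li _ PhiL PsiT pLT]]] := LT x.
  by exists L, T.
(* The inverses start from the fibre over [y]. Keeping [y = phi x] as an equation, used later with
   [x := phi' y], avoids a cast from the fibre over [phi (phi' y)]. *)
have KS x y : y = phi x -> exists KS : {linear fibre V y -> fibre V x}
    * {linear fibre V y -> fibre V x},
  [/\ injective KS.1, restricts_to Phi' KS.1, polar_part g KS.1 KS.2
    & forall b, Psi (incl (KS.2 b)) = incl b].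
  move=> ->; have [L [T [Lbij Tbij PhiL PsiT pLT]]] := LT x.
  have [K [LK KL]] := linear_bij_inverse Lbij.
  have [S [TS ST]] := linear_bij_inverse Tbij.
  exists (K, S); split=> /=; first exact: can_inj KL.
  - by move=> b; rewrite -{1}[b]KL -PhiL PhiK.
  - exact: polar_part_inverse LK KL TS ST pLT.
  - by move=> b; rewrite PsiT ST.
have {}KS y := KS (phi' y) y (esym (phi'K y)).
have [Psi' Psi'S] := total_of_fibrewise (fun y => (sval (cid (KS y))).2).
have Psi's : smooth_on setT Psi'.
  apply: (polar_part_smooth (g := g) Phi's phi's) => y; have := Psi'S y.
  by case: cid => -[K S] /= [Ki Phi'K' pKS _] Psi'S'; exists K, S.
have Psi'K : cancel Psi' Psi.
  move=> v; have [e <-] := incl_surj v; rewrite Psi'S.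
  by case: cid => -[K S] /= [_ _ _ ->].
have Psip : lifts Psi phi.
  move=> v; have [e <-] := incl_surj v; have [L [T [_ _ _ -> _]]] := LT (proj v).
  by rewrite !proj_incl.
(* Injectivity turns the right inverse [Psi'] into a two-sided one: equal images have base points
   with equal images under [phi], and then the injective [T] compares vectors of one fibre. *)
have Psi_inj : injective Psi.
  move=> v w vw; have pvw : proj w = proj v.
    by apply: (can_inj phiK); rewrite -!Psip vw.
  have [a av] := fibre_incl (erefl (proj v)); have [b bw] := fibre_incl pvw.
  have [L [T [_ /bij_inj Ti _ PsiT _]]] := LT (proj v).
  move: vw; rewrite -av -bw !PsiT => /incl_inj /Ti ->.
  by [].
exists Psi; split=> //.
  split; first by split=> //; exists Psi'; split=> // v; apply: Psi_inj; rewrite Psi'K.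
  by move=> x; have [L [T [_ Tbij _ PsiT _]]] := LT x; exists (phi x), T.
by move=> x; have [L [T [_ _ _ PsiT [iso _ _]]]] := LT x; exists T.
Qed.
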